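(* Let $a>b>0$, $c>0$, $H>0$, and put $\lambda=\sqrt{1+H^2/c^2}>1$. Assume $\left|\frac{a^2(1-\lambda^2)}{c^2\lambda^2}\right|<1$. Let $\Sigma$ be the surface $z=c\left(\frac{x^2}{a^2}+\frac{y^2}{b^2}-1\right)^{1/2}$ lying between the planes $z=0$ and $z=H$, i.e. the graph of this function over the region $\{(x,y):1\le \frac{x^2}{a^2}+\frac{y^2}{b^2}\le\lambda^2\}$ (the upper part of the hyperboloid of one sheet $\frac{x^2}{a^2}+\frac{y^2}{b^2}-\frac{z^2}{c^2}=1$), so that its area is $$\hat S=\iint_{1\le x^2/a^2+y^2/b^2\le\lambda^2}\sqrt{1+\Big(\tfrac{\partial z}{\partial x}\Big)^2+\Big(\tfrac{\partial z}{\partial y}\Big)^2}\,dx\,dy .$$ Then $$\hat S=\frac{2\pi b^2c\sqrt{\lambda^2-1}}{\lambda a}\sum_{m,n,p=0}^{\infty}\frac{(\tfrac12)_{n+p}\,(\tfrac12)_m\,(2)_n\,(-\tfrac12)_p\,(-\tfrac12)_p}{(-\tfrac12)_{p-m}\,(\tfrac32)_{n+p}\,(1)_m\;m!\,n!\,p!}\left(\frac{b^2}{a^2}-1\right)^{m}\left(1-\frac{1}{\lambda^2}\right)^{n}\left(\frac{a^2(1-\lambda^2)}{c^2\lambda^2}\right)^{p}.$$ In the notation of Srivastava–Daoust functions this triple series times the prefactor is written $\frac{2\pi b^2c\sqrt{\lambda^2-1}}{\lambda a}F^{1:1;1;2}_{2:1;0;0}\big([\tfrac12:0,1,1]:[\tfrac12:1];[2:1];[-\tfrac12:1],[-\tfrac12:1];\,[-\tfrac12:-1,0,1],[\tfrac32:0,1,1]:[1:1];-;-;\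 \tfrac{b^2}{a^2}-1,\,1-\tfrac1{\lambda^2},\,\tfrac{a^2(1-\lambda^2)}{c^2\lambda^2}\big)$.
   Context: $(\alpha)_k=\Gamma(\alpha+k)/\Gamma(\alpha)$ is the Pochhammer symbol, defined for all integers $k$ (possibly negative) whenever the Gamma quotient is defined; in particular $(-\tfrac12)_{p-m}=\Gamma(-\tfrac12+p-m)/\Gamma(-\tfrac12)$. Note $|b^2/a^2-1|<1$ and $|1-1/\lambda^2|<1$ hold automatically under the hypotheses. *)

(* Defs.v *)
From HB Require Import structures.
From mathcomp Require Import all_boot all_order all_algebra.
From mathcomp Require Import all_classical all_reals all_analysis.
Set Implicit Arguments. Unset Strict Implicit. Unset Printing Implicit Defensive.
Import Order.TTheory GRing.Theory Num.Theory.
Import numFieldNormedType.Exports.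
Local Open Scope ring_scope.

(* Pochhammer symbol (alpha)_k = Gamma(alpha+k)/Gamma(alpha) for k : int,
   written via the functional equation of Gamma:
   k = n >= 0 : alpha (alpha+1) ... (alpha+n-1);
   k = -(j+1) : 1 / ((alpha-1)(alpha-2)...(alpha-(j+1))). *)
Definition poch {R : realType} (alpha : R) (k : int) : R :=
  match k with
  | Posz n => \prod_(i < n) (alpha + i%:R)
  | Negz j => (\prod_(i < j.+1) (alpha - i.+1%:R))^-1
  end.

Definition term {R : realType} (X Y W : R) (m n p : nat) : R :=
  (poch (1/2) (n + p)%:Z * poch (1/2) m%:Z * poch 2 n%:Z
     * poch (-(1/2)) p%:Z * poch (-(1/2)) p%:Z)
  / (poch (-(1/2)) (p%:Z - m%:Z) * poch (3/2) (n + p)%:Z * poch 1 m%:Z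
     * m`!%:R * n`!%:R * p`!%:R)
  * X ^+ m * Y ^+ n * W ^+ p.

Definition zfun {R : realType} (a b c : R) (x y : R) : R :=
  c * Num.sqrt (x ^+ 2 / a ^+ 2 + y ^+ 2 / b ^+ 2 - 1).

Definition area_integrand {R : realType} (a b c : R) (xy : R * R) : R :=
  Num.sqrt (1 + (derive1 (fun t => zfun a b c t xy.2) xy.1) ^+ 2
              + (derive1 (fun t => zfun a b c xy.1 t) xy.2) ^+ 2).

Definition region {R : realType} (a b lam : R) : set (R * R) :=
  [set xy | 1 <= xy.1 ^+ 2 / a ^+ 2 + xy.2 ^+ 2 / b ^+ 2 <= lam ^+ 2].

(* Main.v *)
Require Import Defs.
From HB Require Import structures.
From mathcomp Require Import all_boot all_order all_algebra.
From mathcomp Require Import all_classical all_reals all_analysis.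
From mathcomp Require Import measurable_realfun.
From mathcomp Require Import ring lra.
Import Order.TTheory GRing.Theory Num.Theory.
Import numFieldNormedType.Exports.
Local Open Scope classical_set_scope.
Local Open Scope ring_scope.

(* The slope coordinates (x, y) = (x, (b^2/a^2) s x) followed by a dilation in x
   turn the elliptic annulus into s in R and a radius 1 < r <= lam; putting
   v(s) = 1 - (1 - b^2/a^2) s^2/(1+s^2), the area becomes
     int_s 2 b^2/((1+s^2) v) int_r r sqrt(1 + c^2 r^2/(a^2 v (r^2-1))).
   The slope factor b^2/a^2 is what produces the exponent p - 3/2 of v below, and
   hence the stated series without an Euler transformation of the hypergeometric
   function in b^2/a^2 - 1.
   The substitution r = (1-t^2)^(-1/2) gives the inner integral
     (c/(a sqrt v)) int_0^T (1-t^2)^(-2) sqrt(1 + a^2 v t^2/c^2) dt,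
   where T^2 = 1 - 1/lam^2.  Three binomial expansions, each integrated term by
   term under a summable bound, finish the proof: sqrt(1 + a^2 v t^2/c^2)
   (index p), (1-t^2)^(-2) (index n) and v^(p-3/2) (index m), the last one with
   the Wallis integrals of (s^2/(1+s^2))^m/(1+s^2). *)

(** The integrand blows up along the inner ellipse, where the surface is vertical, and its value on
    that ellipse is meaningless. This forces half-open intervals, the removal of a null set, and a
    substitution rule that tolerates a singular left endpoint. The hypothesis [|W| < 1] says a^2
    T^2/c^2 < 1. Since v <= 1, this is the worst case over all slopes, so the expansion in p
    converges uniformly in s; the lower bound v >= b^2/a^2 controls v^(-3/2). The sum over p has to
    be outermost: the exponent p - 3/2 and the moment index n + p both depend on p, while for fixed
    p a term is a function of m times a function of n. The symbol with a possibly negative index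
    comes from the reflection (-1/2)_(p-m) = (-1)^m (-1/2)_p / (3/2 - p)_m, whose denominator is the
    numerator of the m-th binomial coefficient of v^(p-3/2). *)

Set Implicit Arguments.
Unset Strict Implicit.

(** * Binomial series *)

(* (b)_m / m!, the coefficient of z^m in (1 - z)^(-b); locked so that rewriting
   with product lemmas does not see the quotient. *)
HB.lock Definition binc {R : realType} (b : R) (m : nat) : R :=
  poch b m%:Z / m`!%:R.
Canonical binc_unlockable := Unlockable binc.unlock.

(** Kept free of division: this is the coefficient identity behind the differential equation in
    [binc_ode]. *)
Lemma bincS (R : realType) (b : R) m :
  m.+1%:R * binc b m.+1 = (b + m%:R) * binc b m.
Proof.
rewrite unlock /poch big_ord_recr/= factS natrM.
have h1 : m.+1%:R != 0 :> R by rewrite pnatr_eq0.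
have h2 : m`!%:R != 0 :> R by rewrite pnatr_eq0 -lt0n fact_gt0.
by field; rewrite h2/= nat1r.
Qed.

Lemma bincSr (R : realType) (b : R) m :
  binc b m.+1 = (b + m%:R) * binc b m / m.+1%:R.
Proof.
have m0 : m.+1%:R != 0 :> R by rewrite pnatr_eq0.
have := bincS b m; move: (binc b m.+1) (binc b m) => x y <-.
by rewrite mulrAC mulfV// mul1r.
Qed.

Lemma binc_ge0 (R : realType) (b : R) m : 0 <= b -> 0 <= binc b m.
Proof.
move=> b0; rewrite unlock /poch divr_ge0// prodr_ge0// => i _.
by rewrite addr_ge0.
Qed.

Lemma binc0 (R : realType) (b : R) : binc b 0 = 1.
Proof. by rewrite unlock /poch big_ord0 fact0 divr1. Qed.

Lemma pochS (R : realType) (b : R) m :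
  poch b m.+1%:Z = b * poch (b + 1) m%:Z.
Proof.
rewrite /poch big_ord_recl addr0; congr (_ * _); apply: eq_bigr => i _.
by rewrite lift0 -addrA nat1r.
Qed.

(** Mirrors the derivative b (1 - z)^(-b-1) of (1 - z)^(-b). Formal derivatives stay binomial
    series, so their convergence reduces to [is_cvg_binc]. *)
Lemma pseries_diffs_binc (R : realType) (b : R) :
  pseries_diffs (binc b) = fun m => b * binc (b + 1) m.
Proof.
apply/funext => m; rewrite /pseries_diffs unlock pochS factS natrM.
have h1 : m.+1%:R != 0 :> R by rewrite pnatr_eq0.
have h2 : m`!%:R != 0 :> R by rewrite pnatr_eq0 -lt0n fact_gt0.
by field; rewrite h2/= nat1r.
Qed.

Lemma is_cvg_ratio (R : realType) (u : R^nat) (q : R) (N : nat) :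
  0 <= q < 1 -> (forall m, 0 <= u m) ->
  (forall m, (N <= m)%N -> u m.+1 <= q * u m) -> cvgn (series u).
Proof.
move=> /andP[q0 q1] u0 uq.
have uN k : u (N + k)%N <= u N * q ^+ k.
  elim: k => [|k IH]; first by rewrite addn0 expr0 mulr1.
  rewrite addnS (le_trans (uq _ (leq_addr _ _)))// exprS mulrCA.
  by rewrite ler_wpM2l.
have cg : cvgn (series (geometric (u N) q)).
  by apply: is_cvg_geometric_series; rewrite ger0_norm.
have : cvgn (series (fun k => u (k + N)%N)).
  apply: (series_le_cvg _ _ _ cg).
  - by move=> n.
  - by move=> n; rewrite /geometric /= mulr_ge0 ?exprn_ge0.
  - by move=> n; rewrite /geometric/= addnC.
rewrite -(is_cvg_series_restrict N u) => h.
(* The sums starting at [N] are the shifted series read at n - N (empty for n <= N), so they inherit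
   its limit. *)
suff -> : (fun n : nat => \sum_(N <= k < n) u k) =
   (fun n => series (fun k => u (k + N)%N) (n - N)%N).
  move: h => /cvg_ex[l hl]; apply/cvg_ex; exists l.
  apply: (cvg_comp _ _ _ hl).
  move=> A [n _ nA]; exists (n + N)%N => // k /= nk; apply: nA => /=.
  by rewrite leq_subRL ?(leq_trans (leq_addl _ _) nk)// addnC.
apply/funext => n; rewrite /series/=.
have [Nn|nN] := leqP N n.
  rewrite -{1}(add0n N) -{1}(subnK Nn) big_addn.
  by rewrite addnK.
by rewrite big_geq ?(ltnW nN)// (eqP (ltnW nN)) big_geq.
Qed.

Lemma is_cvg_binc_norm (R : realType) (b z : R) : `|z| < 1 ->
  cvgn (series (fun m => `|binc b m * z ^+ m|)).
Proof.
move=> z1.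
(* [q] is the midpoint of |z| and 1. From [N] on, (|b| + m) |z| <= q (m + 1), because the difference
   of the two sides is (m (1 - |z|) - 2 |b| |z|) / 2 + q. *)
pose q := (1 + `|z|) / 2.
pose N := (Num.truncn (2 * `|b| * `|z| / (1 - `|z|))).+1.
have z0 : 0 <= `|z| by [].
apply: (@is_cvg_ratio _ _ q N).
- by rewrite /q; lra.
- by move=> m.
move=> m Nm.
have m0 : 0 < m.+1%:R :> R by rewrite ltr0n.
have -> : `|binc b m.+1 * z ^+ m.+1| =
   (`|b + m%:R| * `|z|) / m.+1%:R * `|binc b m * z ^+ m|.
  rewrite bincSr.
  move: (binc b m) => c.
  rewrite !normrM exprS !normrM normfV normr_nat. 
  set A := `|b + _|; set B := `|z|; set C := `|c|; set D := `|z ^+ m|; set E := _^-1.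
  ring.
rewrite ler_wpM2r// ler_pdivrMr//.
have h : 2 * `|b| * `|z| / (1 - `|z|) <= m%:R.
  apply: le_trans (_ : N%:R <= _); last by rewrite ler_nat.
  exact/ltW/truncnS_gt.
rewrite ler_pdivrMr in h; last by rewrite subr_gt0.
have h3 : `|b + m%:R| <= `|b| + m%:R.
  by rewrite (le_trans (ler_normD _ _))// normr_nat.
apply: (le_trans (ler_wpM2r z0 h3)).
rewrite /q -[m.+1%:R]natr1 -subr_ge0.
have -> : (1 + `|z|) / 2 * (m%:R + 1) - (`|b| + m%:R) * `|z| =
   (m%:R * (1 - `|z|) - 2 * `|b| * `|z|) / 2 + (1 + `|z|) / 2 by field.
by rewrite addr_ge0 ?divr_ge0 ?subr_ge0 ?addr_ge0.
Qed.

Lemma is_cvg_binc (R : realType) (b z : R) : `|z| < 1 ->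
  cvgn (pseries (binc b) z).
Proof. by move=> z1; apply/normed_cvg/is_cvg_binc_norm. Qed.

Lemma binc_ode (R : realType) (b z : R) : `|z| < 1 ->
  let g := fun z => limn (pseries (binc b) z) in
  exists2 dg, is_derive z 1 g dg & (1 - z) * dg = b * g z.
Proof.
move=> z1 g.
have cd y : `|y| < 1 -> cvgn (pseries (pseries_diffs (binc b)) y).
  move=> y1; rewrite pseries_diffs_binc.
  have -> : pseries (fun m => b * binc (b + 1) m) y =
     (fun n => b * pseries (binc (b + 1)) y n).
    apply/funext => n; rewrite /pseries/series/= mulr_sumr.
    by apply: eq_bigr => i _; rewrite mulrA.
  by apply: is_cvgMr; exact: is_cvg_binc.
have cdd y : `|y| < 1 -> cvgn (pseries (pseries_diffs (pseries_diffs (binc b))) y).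
  move=> y1; rewrite pseries_diffs_binc.
  have -> : pseries_diffs (fun m => b * binc (b + 1) m) =
     fun m => b * (b + 1) * binc (b + 1 + 1) m.
    apply/funext => m; rewrite /pseries_diffs mulrCA.
    by have := congr1 (fun f => f m) (pseries_diffs_binc (b + 1));
      rewrite /pseries_diffs => ->; rewrite mulrA.
  have -> : pseries (fun m => b * (b + 1) * binc (b + 1 + 1) m) y =
     (fun n => b * (b + 1) * pseries (binc (b + 1 + 1)) y n).
    apply/funext => n; rewrite /pseries/series/= mulr_sumr.
    by apply: eq_bigr => i _; rewrite !mulrA.
  by apply: is_cvgMr; exact: is_cvg_binc.
(* Termwise differentiation at z needs the series and its first two formal derivatives to converge
   at a point of larger modulus; [K] lies halfway between |z| and 1. *)
pose K := (1 + `|z|) / 2.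
have K0 : `|K| < 1.
  rewrite ger0_norm; last by rewrite /K; have := normr_ge0 z; lra.
  by rewrite /K; lra.
have zK : `|z| < `|K|.
  rewrite (@ger0_norm _ K); last by rewrite /K; have := normr_ge0 z; lra.
  by rewrite /K; lra.
exists (limn (pseries (pseries_diffs (binc b)) z)).
  exact: (pseries_snd_diffs (is_cvg_binc K0) (cd _ K0) (cdd _ K0) zK).
set dg := limn _.
have h1 := pseries_diffs_equiv (cd _ z1).
have h2 : pseries (binc b) z @ \oo --> g z by exact: is_cvg_binc.
have h3 : pseries (pseries_diffs (binc b)) z @ \oo --> dg by exact: cd.
(* By [bincS] the m-th coefficient of g' is (b + m) times that of g, so the same partial sums also
   tend to z g' + b g; uniqueness of the limit is the equation. *)
have : pseries (pseries_diffs (binc b)) z @ \oo --> z * dg + b * g z.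
  have -> : pseries (pseries_diffs (binc b)) z =
    (fun n => z * series (fun i => i%:R * binc b i * z ^+ i.-1) n
              + b * pseries (binc b) z n).
    apply/funext => n; rewrite /pseries/series/= !mulr_sumr -big_split/=.
    apply: eq_bigr => i _; rewrite /pseries_diffs bincS.
    case: i => [|i]; first by rewrite expr0/=; ring.
    by rewrite /= exprS; ring.
  by apply: cvgD; apply: cvgMr.
move=> /(cvg_lim (@Rhausdorff R)) e; rewrite -/dg in e.
rewrite mulrBl mul1r [X in X - _]e addrAC subrr add0r //.
Qed.

(** The product of the sum g(y) with (1 - y)^b has zero derivative on ]-1, 1[ by [binc_ode] and
    equals 1 at 0. The mean value theorem between 0 and z replaces any remainder estimate. *)
Lemma binomial_series (R : realType) (b z : R) : `|z| < 1 ->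
  pseries (binc b) z @ \oo --> (1 - z) `^ (- b).
Proof.
move=> z1.
pose g := fun z => limn (pseries (binc b) z).
have gc : pseries (binc b) z @ \oo --> g z by exact: is_cvg_binc.
suff : g z = (1 - z) `^ (- b) by move=> <-.
pose h := fun y => g y * (1 - y) `^ b.
have h0 : h 0 = 1.
  rewrite /h subr0 powR1 mulr1 /g.
  suff -> : pseries (binc b) 0 = fun n => (n != 0)%:R.
    apply/cvg_lim => //; apply/cvgrPdist_le => e e0; near=> n.
    have -> : n != 0 by rewrite -lt0n; near: n; exact: nbhs_infty_gt.
    by rewrite subrr normr0 ltW.
  apply/funext => -[|n]; rewrite /pseries/series/=; first by rewrite big_geq.
  rewrite big_nat_recl// expr0 mulr1 binc0 big1 ?addr0// => i _.
  by rewrite expr0n mulr0.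
have dh (y : R) : `|y| < 1 -> is_derive y 1 h 0.
  move=> y1; have [dg idg ode] := @binc_ode _ b y y1.
  have y10 : 0 < 1 - y by rewrite subr_gt0 (le_lt_trans (ler_norm _)).
  have dp : is_derive y 1 (fun y : R => (1 - y) `^ b) (- (b * (1 - y) `^ (b - 1))).
    pose f1 : R -> R := fun y : R => 1 - y.
    have d1 : is_derive y 1 f1 (- 1).
      rewrite /f1; apply: is_derive_eq; ring.
    have d2 : is_derive (f1 y) 1 (fun x : R => x `^ b) (b * (1 - y) `^ (b - 1)).
      exact: is_derive1_powR.
    have := @is_derive1_comp R (fun x : R => x `^ b) f1 y _ _ d2 d1.
    by rewrite mulrN1.
  rewrite /h; apply: is_derive_eq.
  rewrite /GRing.scale/=.
  have -> : (1 - y) `^ b = (1 - y) * (1 - y) `^ (b - 1).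
    rewrite -{2}(@powRr1 _ (1 - y)) ?ltW// -powRD; first by congr (_ `^ _); ring.
    by apply/implyP => _; rewrite gt_eqF.
  have -> : (1 - y) * (1 - y) `^ (b - 1) * dg = (1 - y) `^ (b - 1) * (b * g y).
    by rewrite -ode; ring.
  ring.
have hz : h z = h 0.
  have [z0|z0|->//] := ltgtP z 0.
  - have := @MVT _ h (cst 0) z 0 z0.
    have cH : {within `[z, 0], continuous h}.
      apply: derivable_within_continuous => y; rewrite in_itv/= => /andP[zy y0].
      have /dh[] // : `|y| < 1.
      by move: z1; rewrite !ltr_norml => /andP[? ?]; apply/andP; split; lra.
    move=> /(_ _ cH)[|y _].
      move=> y; rewrite in_itv/= => /andP[zy y0].
      apply: dh; by move: z1; rewrite !ltr_norml => /andP[? ?]; apply/andP; split; lra.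
    by rewrite /cst mul0r => /eqP; rewrite subr_eq0 => /eqP.
  - have := @MVT _ h (cst 0) 0 z z0.
    have cH : {within `[0, z], continuous h}.
      apply: derivable_within_continuous => y; rewrite in_itv/= => /andP[zy y0].
      have /dh[] // : `|y| < 1.
      by move: z1; rewrite !ltr_norml => /andP[? ?]; apply/andP; split; lra.
    move=> /(_ _ cH)[|y _].
      move=> y; rewrite in_itv/= => /andP[zy y0].
      apply: dh; by move: z1; rewrite !ltr_norml => /andP[? ?]; apply/andP; split; lra.
    by rewrite /cst mul0r => /eqP; rewrite subr_eq0 => /eqP.
have p0 : 0 < (1 - z) `^ b.
  by apply: powR_gt0; rewrite subr_gt0 (le_lt_trans (ler_norm _)).
rewrite powRN; apply: (mulIf (lt0r_neq0 p0)).
by rewrite mulVf ?gt_eqF// -/(h z) hz h0.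
Unshelve. all: by end_near. Qed.

(** * Termwise integration and dilations of Lebesgue measure *)

(** Dominated convergence, with the sum of [M] times [w] as dominating function. Keeping the weight
    [w] apart lets the terms be bounded by constants. The convergence of [series I] is a conclusion,
    and it is the source of the convergence claims about the iterated series. *)
Lemma integral_dominated_series d (T : measurableType d) (R : realType)
    (mu : {measure set T -> \bar R}) (D : set T) (w f : T -> R)
    (u : nat -> T -> R) (M I : R^nat) :
  measurable D ->
  mu.-integrable D (EFin \o w) -> (forall x, D x -> 0 <= w x) ->
  (forall k, measurable_fun D (u k)) ->
  (forall k x, D x -> `|u k x| <= M k) -> cvgn (series M) ->
  (forall x, D x -> series (u ^~ x) @ \oo --> f x) ->
  (forall k, \int[mu]_(x in D) (w x * u k x)%:E = (I k)%:E)%E ->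
  [/\ cvgn (series I), mu.-integrable D (fun x => (w x * f x)%:E) &
    (\int[mu]_(x in D) (w x * f x)%:E = (limn (series I))%:E)%E].
Proof.
move=> mD iw w0 mu_ uM cM uf Ik.
have mw : measurable_fun D w by apply/measurable_EFinP; case/integrableP : iw.
have mf : measurable_fun D f.
  apply: (@measurable_fun_cvg _ _ _ D (fun n x => series (u ^~ x) n)) => //.
  by move=> m; rewrite /series/=; apply: measurable_sum.
have iu k : mu.-integrable D (fun x => (w x * u k x)%:E).
  have i2 : mu.-integrable D (fun x => ((M k)%:E * (w x)%:E)%E).
    exact: integrableZl.
  apply: (le_integrable mD _ _ i2).
    by apply/measurable_EFinP; exact: measurable_funM.
  move=> x Dx; rewrite -EFinM !abse_EFin lee_fin !normrM mulrC.
  rewrite (ger0_norm (w0 _ Dx)) ler_wpM2r ?w0//.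
  by rewrite (le_trans (uM _ _ Dx))// ler_norm.
set L := limn (series M).
have i3 : mu.-integrable D (fun x => (L%:E * (w x)%:E)%E) by exact: integrableZl.
have h := @dominated_convergence _ _ _ mu D mD
  (fun n x => (w x * series (u ^~ x) n)%:E) (fun x => (w x * f x)%:E)
  (fun x => (L%:E * (w x)%:E)%E).
have [|||||iwf _ cv] := h.
- move=> n; apply/measurable_EFinP; apply: measurable_funM => //.
  by rewrite /series/=; apply: measurable_sum.
- by apply/measurable_EFinP; exact: measurable_funM.
- apply: aeW => x Dx; apply: cvg_EFin; first by near=> n.
  by apply: cvgMr; exact: uf.
- exact: i3.
- apply: aeW => x n Dx; rewrite -EFinM abse_EFin lee_fin normrM mulrC.
  rewrite (ger0_norm (w0 _ Dx)) ler_wpM2r ?w0//.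
  have M0 k : 0 <= M k by rewrite (le_trans _ (uM k _ Dx)).
  apply: (@le_trans _ _ (series M n)).
    rewrite /series/= (le_trans (ler_norm_sum _ _ _))//.
    by apply: ler_sum => i _; exact: uM.
  apply: nondecreasing_cvgn_le => //.
  by apply/nondecreasing_seqP => m; rewrite /series/= big_nat_recr//= lerDl.
have fwf : (\int[mu]_(x in D) (w x * f x)%:E)%E \is a fin_num.
  exact: integrable_fin_num.
(* Integrals of partial sums are partial sums of [I], so convergence is carried over from the
   extended reals without any estimate on [I]. *)
have sI : series I @ \oo --> fine (\int[mu]_(x in D) (w x * f x)%:E)%E.
  have : (fun n => (series I n)%:E) @ \oo --> (fine (\int[mu]_(x in D) (w x * f x)%:E)%E)%:E.
    rewrite fineK//; apply: cvg_trans cv; apply: near_eq_cvg; near=> n.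
    rewrite /series/= -sumEFin.
    under eq_integral do rewrite mulr_sumr -sumEFin.
    rewrite integral_sum//.
    by apply: eq_bigr => i _.
  by move=> /fine_cvgP[_].
split=> //; first by apply/cvg_ex; exists (fine (\int[mu]_(x in D) (w x * f x)%:E)%E).
by rewrite (cvg_lim _ sI)// fineK.
Unshelve. all: by end_near. Qed.

(** The real power with exponent -1 agrees with the inverse on nonnegative bases, so it is applied
    to x^2; at 0 both sides are 0. *)
Lemma measurable_invr (R : realType) : measurable_fun setT (fun x : R => x^-1).
Proof.
have -> : (fun x : R => x^-1) = fun x => x * (x ^+ 2) `^ (-1).
  apply/funext => x; rewrite powR_inv1 ?sqr_ge0//.
  have [->|x0] := eqVneq x 0; first by rewrite invr0 mul0r.
  by field.
apply: measurable_funM => //; apply: (measurableT_comp (@measurable_powR R (-1))).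
exact: measurable_funX.
Qed.

(** By uniqueness of Lebesgue measure it is enough to compare half-open intervals. A negative [k]
    swaps the ends and the closed side, which leaves the length unchanged. *)
Lemma lebesgue_measure_scale (R : realType) (k : R) (A : set R) : k != 0 ->
  measurable A ->
  (@lebesgue_measure R A = `|k|%:E *
    pushforward (@lebesgue_measure R) (( *%R k) : _ -> measurableTypeR R) A)%E.
Proof.
move=> k0 mA.
have mk : measurable_fun setT (( *%R k) : measurableTypeR R -> measurableTypeR R).
  exact: mulrl_measurable.
pose nk : {nonneg R} := NngNum (normr_ge0 k).
pose mkM := isMeasurableFun.Build _ _ _ _ _ mk.
pose mkP : {mfun measurableTypeR R >-> measurableTypeR R} := HB.pack ( *%R k) mkM.
apply: (@lebesgue_measure_unique R (mscale nk (pushforward (@lebesgue_measure R) mkP))) => //= _ [[a b]] _ <-.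
rewrite /mscale/= /pushforward/=.
have [kn|kp|/eqP] := ltgtP k 0; last by rewrite (negbTE k0).
- have -> : *%R k @^-1` `]a, b] = `[b / k, a / k[%classic.
    apply/seteqP; split => x/=; rewrite !in_itv/=.
      by rewrite ler_ndivrMr// ltr_ndivlMr// mulrC => /andP[-> ->].
    by rewrite ler_ndivrMr// ltr_ndivlMr// mulrC => /andP[-> ->].
  rewrite !lebesgue_measure_itv/= !lte_fin ltr_ndivlMr// divfK//.
  case: ifPn => ab; last by rewrite mule0.
  by rewrite -!EFinB -EFinM ltr0_norm//; congr EFin; field.
- have -> : *%R k @^-1` `]a, b] = `]a / k, b / k]%classic.
    apply/seteqP; split => x/=; rewrite !in_itv/=.
      by rewrite ltr_pdivrMr// ler_pdivlMr// mulrC => /andP[-> ->].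
    by rewrite ltr_pdivrMr// ler_pdivlMr// mulrC => /andP[-> ->].
  rewrite !lebesgue_measure_itv/= !lte_fin ltr_pdivrMr// divfK//.
  case: ifPn => ab; last by rewrite mule0.
  by rewrite -!EFinB -EFinM gtr0_norm//; congr EFin; field.
Qed.

(** Both signs of [k] are covered because [slope_coordinates] dilates by [k * x] with [x] of either
    sign. *)
Lemma ge0_integral_scale (R : realType) (k : R) (f : R -> \bar R) : k != 0 ->
  measurable_fun setT f -> (forall x, 0 <= f x)%E ->
  (\int[@lebesgue_measure R]_x f x =
   `|k|%:E * \int[@lebesgue_measure R]_x f (k * x)%R)%E.
Proof.
move=> k0 mf f0.
have mk : measurable_fun setT (( *%R k) : measurableTypeR R -> measurableTypeR R).
  exact: mulrl_measurable.
pose nk : {nonneg R} := NngNum (normr_ge0 k).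
pose mkM := isMeasurableFun.Build _ _ _ _ _ mk.
pose mkP : {mfun measurableTypeR R >-> measurableTypeR R} := HB.pack ( *%R k) mkM.
pose pm : {measure set (measurableTypeR R) -> \bar R} := pushforward (@lebesgue_measure R) mkP.
transitivity (\int[mscale nk (pm mk)]_x f x)%E.
  apply: eq_measure_integral => A mA _.
  exact: lebesgue_measure_scale.
rewrite ge0_integral_mscale//=; congr (_ * _)%E.
by rewrite ge0_integral_pushforward.
Qed.

(** * Wallis integrals *)

Lemma cvg_atan_pinfty (R : realType) : atan x @[x --> +oo] --> (pi / 2 : R).
Proof.
apply/cvgrPdist_le => e e0.
pose d := Num.min e (pi / 2).
have pi0 : 0 < pi / 2 :> R by rewrite divr_gt0// pi_gt0.
have d0 : 0 < d by rewrite lt_min e0.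
have dI : pi / 2 - d \in `](- (pi / 2)), (pi / 2)[.
  rewrite in_itv/=; apply/andP; split; last by rewrite ltrBlDr ltrDl.
  have : d <= pi / 2 by rewrite ge_min lexx orbT.
  by move: pi0; lra.
near=> x.
have xt : tan (pi / 2 - d) < x.
  by near: x; apply: nbhs_pinfty_gt; exact: num_real.
rewrite ger0_norm ?subr_ge0 ?ltW ?atan_ltpi2//.
have : pi / 2 - d < atan x.
  rewrite -ltr_tan ?atanK// in_itv/= atan_gtNpi2 atan_ltpi2//.
have : d <= e by rewrite ge_min lexx.
lra.
Unshelve. all: by end_near. Qed.

Lemma onep_sqr_gt0 (R : realType) (s : R) : 0 < 1 + s ^+ 2.
Proof. by rewrite ltr_pwDl// sqr_ge0. Qed.

(** Integration by parts in antiderivative form, together with the limit at infinity, so that the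
    fundamental theorem applies on the whole half-line. *)
Lemma wallis_antiderivative (R : realType) (m : nat) :
  exists F : R -> R,
    [/\ forall s : R, is_derive s 1 F
          ((s ^+ 2 / (1 + s ^+ 2)) ^+ m / (1 + s ^+ 2)),
        F 0 = 0 & F s @[s --> +oo] --> pi / 2 * binc (1 / 2) m].
Proof.
elim: m => [|m [F [dF F0 cF]]].
  exists atan; split; rewrite ?atan0 ?binc0 ?mulr1//; last exact: cvg_atan_pinfty.
  by move=> s; rewrite expr0 mul1r; exact: is_derive1_atan.
(* [V] is made opaque, known only through its values and its derivative, so that the derivative
   computations below are polynomial in s and V s. *)
have [V [VE dV]] : exists V : R -> R, (forall s, V s = (1 + s ^+ 2)^-1) /\
    (forall s : R, is_derive s 1 V (- (2 * s) * V s ^+ 2)).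
  exists (fun s => (1 + s ^+ 2)^-1); split => // s.
  have s0 : 1 + s ^+ 2 != 0 by rewrite gt_eqF// onep_sqr_gt0.
  pose q (s : R) : R := 1 + s ^+ 2.
  have dq : is_derive s 1 q (2 * s).
    by rewrite /q; apply: is_derive_eq; rewrite /GRing.scale/=; ring.
  have := @is_deriveV _ q _ _ _ s0 dq; rewrite /q /GRing.scale/=.
  by rewrite mulNr mulrC -mulNr exprVn.
(* With u = s^2 V, the derivative of [g] is u^m V ((2m + 1) - 2 (m + 1) u). Solving for u^(m+1) V
   gives the next antiderivative. *)
pose g (s : R) : R := s * V s * (s ^+ 2 * V s) ^+ m.
exists (fun s => ((2 * m%:R + 1) * F s - g s) / (2 * m.+1%:R)); split.
- move=> s; rewrite -VE.
  have dg : is_derive s 1 g ((s ^+ 2 * V s) ^+ m * V s *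
     ((2 * m%:R + 1) - 2 * m.+1%:R * (s ^+ 2 * V s))).
    rewrite /g; case: (m) => [|k].
      have -> : (fun s : R => s * V s * (s ^+ 2 * V s) ^+ 0) = (fun s => s * V s).
        by apply/funext => y; rewrite mulr1.
      apply: is_derive_eq; rewrite /GRing.scale/= expr0.
      transitivity (V s * (1 - 2 * (s ^+ 2 * V s))); ring.
    pose h (s : R) : R := s ^+ 2 * V s; pose H (s : R) : R := h s ^+ k.+1.
    have dh : is_derive s 1 h (2 * s * V s - s ^+ 2 * (2 * s) * V s ^+ 2).
      by rewrite /h; apply: is_derive_eq; rewrite /GRing.scale/=; ring.
    have dH : is_derive s 1 H (k.+1%:R * h s ^+ k * (2 * s * V s - s ^+ 2 * (2 * s) * V s ^+ 2)).
      have -> : H = (h ^+ k.+1) by apply/funext => y; rewrite exprfctE.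
      by apply: (is_derive_eq (@is_deriveX _ _ h k.+1 s 1 _ dh)).
    have dS : is_derive s 1 (fun s => s * V s) (V s - s * (2 * s) * V s ^+ 2).
      by apply: is_derive_eq; rewrite /GRing.scale/=; ring.
    apply: (is_derive_eq (is_deriveM dS dH)); rewrite /GRing.scale/= /H !(exprS _ k) -/(h s).
    rewrite -[k.+2%:R]natr1 -[k.+1%:R]natr1.
    set P := _ ^+ k; move: P => P; rewrite /h.
    ring.
  have dF' := dF s; rewrite -VE in dF'.
  pose C := (2 * m.+1%:R : R)^-1; pose K := (2 * m%:R + 1 : R).
  have -> : (fun s => (K * F s - g s) / (2 * m.+1%:R)) = (fun s => C * (K * F s - g s)).
    by apply/funext => y; rewrite mulrC.
  apply: is_derive_eq; rewrite /GRing.scale/= (exprS _ m) /C /K.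
  have N0 : m.+1%:R != 0 :> R by rewrite pnatr_eq0.
  by move: m.+1%:R N0 (_ ^+ m) => N N0 P; field.
- by rewrite F0 /g !mul0r mulr0 subr0 mul0r.
(* The boundary term vanishes because u <= 1 gives 0 <= g s <= s / (1 + s^2) <= 1/s. *)
have g0 : g s @[s --> +oo] --> 0.
  apply: (@squeeze_cvgr _ _ _ _ (cst 0) (fun s => s^-1)).
  - near=> s.
    have s0 : 0 < s by near: s; apply: nbhs_pinfty_gt; exact: num_real.
    have p0 := onep_sqr_gt0 s.
    have q0 : 0 <= s ^+ 2 / (1 + s ^+ 2) by rewrite divr_ge0 ?sqr_ge0// ltW.
    have r0 : 0 <= s / (1 + s ^+ 2) by rewrite divr_ge0 // ltW.
    rewrite /g VE; apply/andP; split; first by rewrite mulr_ge0 ?exprn_ge0.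
    apply: (@le_trans _ _ (s / (1 + s ^+ 2))).
      rewrite ler_piMr// exprn_ile1// ler_pdivrMr// mul1r lerDr.
      exact: ler01.
    rewrite ler_pdivrMr// -ler_pdivrMl ?invr_gt0// invrK -expr2 lerDr.
    exact: ler01.
  - exact: cvg_cst.
  - apply/gtr0_cvgV0; first by near=> s; near: s; apply: nbhs_pinfty_gt; exact: num_real.
    exact: cvg_id.
have -> : pi / 2 * binc (1 / 2) m.+1 =
   ((2 * m%:R + 1) * (pi / 2 * binc (1 / 2) m) - 0) / (2 * m.+1%:R) :> R.
  have m0 : m.+1%:R != 0 :> R by rewrite pnatr_eq0.
  rewrite bincSr; move: (binc _ m) => y.
  have e : m.+1%:R = m%:R + 1 :> R by rewrite natr1.
  by field.
by apply: cvgMl; apply: cvgB => //; apply: cvgMr.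
Unshelve. all: by end_near. Qed.

(** With s = tan(theta) this is the integral of sin^(2m) over ]-pi/2, pi/2[. *)
Lemma wallis_integral (R : realType) (m : nat) :
  (\int[@lebesgue_measure R]_s ((1 + s ^+ 2)^-1 *
     (s ^+ 2 / (1 + s ^+ 2)) ^+ m)%:E = (pi * binc (1 / 2) m)%:E)%E.
Proof.
pose f (s : R) : R := (1 + s ^+ 2)^-1 * (s ^+ 2 / (1 + s ^+ 2)) ^+ m.
have f0 s : 0 <= f s.
  by rewrite /f mulr_ge0 ?invr_ge0 ?exprn_ge0 ?divr_ge0 ?sqr_ge0 ?ltW ?onep_sqr_gt0.
have cV : continuous (fun s : R => (1 + s ^+ 2)^-1).
  move=> s; apply: cvgV; first by rewrite gt_eqF// onep_sqr_gt0.
  by apply: cvgD; [exact: cvg_cst|exact: exprn_continuous].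
have cf : continuous f.
  move=> s; apply: cvgM; first exact: cV.
  have h : (fun s : R => s ^+ 2 / (1 + s ^+ 2)) @ s --> s ^+ 2 / (1 + s ^+ 2).
    by apply: cvgM; [exact: exprn_continuous|exact: cV].
  exact: (cvg_comp _ _ h (@exprn_continuous _ m _)).
rewrite (_ : (fun s => _) = (EFin \o f))// ge0_symfun_integralT//; last first.
  by move=> s; rewrite /f/= sqrrN.
have [F [dF F0 cF]] := wallis_antiderivative R m.
rewrite -set_itvcy (@ge0_continuous_FTC2y _ f F 0 (pi / 2 * binc (1 / 2) m))//.
- by rewrite F0 sube0 -EFinM; congr EFin; field.
- exact: continuous_subspaceT.
- apply: cvg_at_right_filter; apply: differentiable_continuous.
  by apply/derivable1_diffP; have [] := dF 0.
- by move=> x _; rewrite derive1E; have [_ ->] := dF x; rewrite /f mulrC.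
Qed.

(** * Slope coordinates in the plane *)

Import HBNNSimple.

(* No measurability is required on the null set: on the ellipse itself the partial
   derivatives in area_integrand are junk values of derive1. *)
Lemma ge0_integral_setD_null d (T : measurableType d) (R : realType)
    (mu : {measure set T -> \bar R}) (D N : set T) (f : T -> \bar R) :
  measurable N -> mu N = 0%E -> measurable D -> (forall x, 0 <= f x)%E ->
  measurable_fun (D `\` N) f ->
  (\int[mu]_(x in D) f x = \int[mu]_(x in D `\` N) f x)%E.
Proof.
move=> mN N0 mD f0 mf.
have mDN : measurable (D `\` N) by exact: measurableD.
rewrite integral_mkcond [RHS]integral_mkcond.
have r0 A x : (0 <= (f \_ A) x)%E by rewrite erestrict_ge0.
rewrite !ge0_integralTE//.
apply/eqP; rewrite eq_le; apply/andP; split; last first.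
  apply: le_ereal_sup => _ [h hf <-]; exists h => // x.
  apply: (le_trans (hf x)); rewrite /patch.
  case: ifPn => [|_]; last by case: ifPn.
  by rewrite inE => -[Dx _]; rewrite mem_set.
(* A simple function below f is measurable whatever f is, so [N] can be removed from its integral;
   what remains lies below f restricted to D minus N. *)
apply: ge_ereal_sup => _ [h hf <-].
rewrite -integralT_nnsfun -ge0_integralTE//.
rewrite (@ge0_negligible_integral _ _ _ mu setT N)//; last 2 first.
  exact/measurable_EFinP.
  by move=> x _; rewrite lee_fin.
rewrite [leRHS](_ : _ = \int[mu]_(x in setT `\` N) (f \_ (D `\` N)) x)%E; last first.
  rewrite [RHS]integral_mkcond; apply: eq_integral => x _.
  rewrite /patch; case: ifPn => // h1; case: ifPn => // h2.
  by exfalso; move: h1 h2; rewrite inE notin_setE => -[_ xN]; apply; split.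
apply: ge0_le_integral => //.
- by apply: measurableD.
- by move=> x _; rewrite lee_fin.
- by apply/measurable_funTS/measurable_EFinP.
- by apply: measurable_funTS; exact/(measurable_restrictT _ mDN).
- move=> x [_ Nx]; apply: (le_trans (hf x)); rewrite /patch.
  case: ifPn => // Dx; case: ifPn => //.
  by rewrite notin_setE => -[]; split => //; rewrite inE in Dx.
Qed.

(** No planar change of variables is involved: for fixed x != 0 the inner integral is dilated by
    [k * x], and Tonelli exchanges the order. The dilation degenerates at x = 0, a null set that is
    removed on both sides. *)
Lemma slope_coordinates (R : realType) (F : R * R -> \bar R) (k : R) :
  measurable_fun setT F -> (forall z, 0 <= F z)%E -> 0 < k ->
  (\int[(@lebesgue_measure R \x @lebesgue_measure R)%E]_z F z =
   \int[@lebesgue_measure R]_s \int[@lebesgue_measure R]_x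
     ((k * `|x|)%:E * F (x, k * x * s)%R))%E.
Proof.
move=> mF F0 k0.
pose G (z : R * R) : \bar R := ((k * `|z.1|)%:E * F (z.1, k * z.1 * z.2)%R)%E.
have mG : measurable_fun setT G.
  apply: emeasurable_funM.
    apply/measurable_EFinP; apply: measurable_funM => //.
    by apply: measurableT_comp => //; exact: measurable_fst.
  apply: (measurableT_comp mF).
  apply: measurable_fun_pair => /=; first exact: measurable_fst.
  apply: measurable_funM; last exact: measurable_snd.
  by apply: measurable_funM => //; exact: measurable_fst.
have G0 z : (0 <= G z)%E.
  by rewrite /G mule_ge0// lee_fin mulr_ge0// ltW.
rewrite fubini_tonelli1//.
transitivity (\int[@lebesgue_measure R]_x \int[@lebesgue_measure R]_s G (x, s))%E; last first.
  exact: (@fubini_tonelli _ _ _ _ _ (@lebesgue_measure R) (@lebesgue_measure R) G).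
have m0 : @lebesgue_measure R [set 0] = 0%E by exact: lebesgue_measure_set1.
have mF1 := @measurable_fun_fubini_tonelli_F _ _ _ _ _ (@lebesgue_measure R) F mF F0.
have mG1 := @measurable_fun_fubini_tonelli_F _ _ _ _ _ (@lebesgue_measure R) G mG G0.
rewrite (@ge0_negligible_integral _ _ _ (@lebesgue_measure R) setT [set 0])//; last first.
  by move=> x _; apply: integral_ge0.
rewrite [RHS](@ge0_negligible_integral _ _ _ (@lebesgue_measure R) setT [set 0])//; last first.
  by move=> x _; apply: integral_ge0.
apply: eq_integral => x; rewrite inE => -[_ /eqP x0].
rewrite /fubini_F/= (@ge0_integral_scale _ (k * x))//; last 2 first.
- by rewrite mulf_neq0// gt_eqF.
- exact: measurableT_comp.
rewrite -ge0_integralZl//; last first.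
  apply: (measurableT_comp mF); apply: measurable_fun_pair => //=; exact: mulrl_measurable.
by apply: eq_integral => s _; rewrite /G/= normrM (gtr0_norm k0).
Qed.

Lemma ge0_integral_even (R : realType) (f : R -> \bar R) :
  measurable_fun setT f -> (forall x, 0 <= f x)%E -> (forall x, f (- x)%R = f x) ->
  (\int[@lebesgue_measure R]_x f x =
   2%:E * \int[@lebesgue_measure R]_(x in `]0%R, +oo[) f x)%E.
Proof.
move=> mf f0 fe.
have m0 : @lebesgue_measure R [set 0] = 0%E by exact: lebesgue_measure_set1.
rewrite -(setUv `]0, +oo[%classic) ge0_integral_setU//=; last 3 first.
- exact: measurableC.
- by rewrite setUv.
- exact/disj_setPCl.
rewrite setCitvr.
have <- : (\int[@lebesgue_measure R]_(x in `[0%R, +oo[) f x =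
   \int[@lebesgue_measure R]_(x in `]-oo, 0%R]) f x)%E.
  rewrite ge0_integration_by_substitution0//.
  by apply: eq_integral => x _.
rewrite -[in X in (_ + X)%E]integral_itv_obnd_cbnd; last exact: measurable_funTS.
by rewrite mule_natl mule2n.
Qed.

(** * Change of variables on a half-open interval *)

(** [G] may be singular at F a. The closed-interval rule is applied on [s n, b] with s n decreasing
    to a, and monotone convergence handles the limit on both sides. The room up to [c] makes F
    differentiable on both sides of b. *)
Lemma ge0_integration_by_substitution_incr_obnd (R : realType)
    (F F' G : R -> R) (a b c : R) : a < b -> b < c ->
  {in `[a, b] &, {homo F : x y / x < y}} ->
  {in `]a, c[, forall x : R, is_derive x 1 F (F' x)} ->
  {in `]a, c[, continuous F'} ->
  F x @[x --> a^'+] --> F a ->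
  (forall y, F a < y -> {for y, continuous G}) ->
  (forall y, F a < y -> 0 <= G y) ->
  {in `]a, b], forall x, 0 <= F' x} ->
  measurable_fun `]F a, F b] G ->
  measurable_fun `]a, b] ((G \o F) * F') ->
  (\int[@lebesgue_measure R]_(x in `]F a, F b]) (G x)%:E =
   \int[@lebesgue_measure R]_(x in `]a, b]) (((G \o F) * F') x)%:E)%E.
Proof.
move=> ab bc incF dF cF' Fa cG G0 F'0 mG mGF.
have incFle : {in `[a, b] &, {homo F : x y / x <= y}}.
  by move=> x y xab yab; rewrite le_eqVlt => /predU1P[->//|xy]; rewrite ltW// incF.
have aI : a \in `[a, b] by rewrite in_itv/= lexx ltW.
have bI : b \in `[a, b] by rewrite in_itv/= lexx ltW.
(* The denominator n + 2 keeps s n strictly below b already at n = 0. *)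
pose s (n : nat) := a + (b - a) / n.+2%:R.
have s1 n : a < s n < b.
  rewrite /s ltrDl divr_gt0 ?subr_gt0//= -ltrBrDl ltr_pdivrMr//.
  by rewrite ltr_pMr ?subr_gt0// ltr1n.
have sI n : s n \in `[a, b].
  by rewrite in_itv/=; have /andP[/ltW -> /ltW ->] := s1 n.
have sdec n m : (n <= m)%N -> s m <= s n.
  move=> nm; rewrite /s lerD2l ler_pM2l ?subr_gt0//.
  by rewrite lef_pV2 ?posrE// ler_nat !ltnS.
have scvg : s n @[n --> \oo] --> a.
  rewrite -[X in _ --> X]addr0; apply: cvgD; first exact: cvg_cst.
  rewrite -(mulr0 (b - a)); apply: cvgMr.
  have h := @cvg_harmonic R; rewrite -cvg_shiftS in h.
  exact: h.
have scvgr : s n @[n --> \oo] --> a^'+.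
  move=> A /= [e e0 eA].
  have : \forall n \near \oo, `|a - s n| < e by move/cvgrPdist_lt : scvg; exact.
  apply: filterS => n ane; apply: eA => //=.
  by have /andP[] := s1 n.
have Fs : F (s n) @[n --> \oo] --> F a by exact: (cvg_comp _ _ scvgr Fa).
have dd (x : R) : a < x < c -> (derive1 F) x = F' x.
  move=> xac; rewrite derive1E; have [|_ ->//] := dF x.
  by rewrite in_itv.
(* The closed-interval rule speaks of [derive1 F], which agrees with F' near each interior point and
   so inherits its continuity. *)
have cd (x : R) : a < x < c -> {for x, continuous (derive1 F)}.
  move=> xac.
  have h : {near x, (derive1 F) =1 F'}.
    have : x \in `]a, c[ by rewrite in_itv.
    move=> /near_in_itvoo; apply: filterS => y.
    by rewrite in_itv/= => /dd.
  rewrite /prop_for /continuous_at dd//.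
  have : F' y @[y --> x] --> F' x by apply: cF'; rewrite in_itv.
  apply: cvg_trans; apply: near_eq_cvg.
  by apply: filterS h => y ->.
have cFx (x : R) : a < x < c -> {for x, continuous F}.
  move=> xac; apply: differentiable_continuous; apply/derivable1_diffP.
  by have [] := dF x; rewrite ?in_itv.
have sE n : (\int[@lebesgue_measure R]_(x in `[F (s n), F b]) (G x)%:E =
   \int[@lebesgue_measure R]_(x in `[s n, b]) (((G \o F) * F') x)%:E)%E.
  have /andP[asn snb] := s1 n.
  have snc : s n < c by exact: lt_trans bc.
  rewrite (@integration_by_substitution_increasing R F G) ?(ltW snb)//.
  - apply: eq_integral => x; rewrite inE/= in_itv/= => /andP[snx xb].
    by rewrite /= !fctE/= dd// (lt_le_trans asn)// (le_lt_trans xb).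
  - move=> x y; rewrite !in_itv/= => /andP[snx xb] /andP[sny yb]; apply: incF.
      by rewrite in_itv/= xb (le_trans (ltW asn)).
    by rewrite in_itv/= yb (le_trans (ltW asn)).
  - move=> x; rewrite in_itv/= => /andP[snx xb]; apply: cd.
    by rewrite (lt_trans asn)// (lt_trans xb).
  - apply/cvg_ex; exists ((derive1 F) (s n)).
    by apply: cvg_at_right_filter; apply: cd; rewrite asn.
  - apply/cvg_ex; exists ((derive1 F) b).
    by apply: cvg_at_left_filter; apply: cd; rewrite ab.
  - split.
    + move=> x; rewrite in_itv/= => /andP[snx xb].
      have [] // := dF x; rewrite in_itv/= (lt_trans asn)// (lt_trans xb)//.
    + by apply: cvg_at_right_filter; apply: cFx; rewrite asn.
    + by apply: cvg_at_left_filter; apply: cFx; rewrite ab.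
  - apply: continuous_in_subspaceT => y; rewrite inE/= in_itv/= => /andP[y1 _].
    by apply: cG; rewrite (lt_le_trans _ y1)// incF.
have U1 : `]F a, F b]%classic = \bigcup_n `[F (s n), F b]%classic.
  apply/seteqP; split => y /=; rewrite in_itv/=.
    move=> /andP[Fay yFb].
    have : \forall n \near \oo, F (s n) < y.
      exact: (cvgr_lt (F a)).
    move=> /filter_ex[n nn]; exists n => //=.
    by rewrite in_itv/= yFb ltW.
  move=> [n _]/=; rewrite in_itv/= => /andP[y1 ->]; rewrite andbT.
  by rewrite (lt_le_trans _ y1)// incF//; have /andP[] := s1 n.
have U2 : `]a, b]%classic = \bigcup_n `[s n, b]%classic.
  apply/seteqP; split => y /=; rewrite in_itv/=.
    move=> /andP[ay yb].
    have : \forall n \near \oo, s n < y by exact: (cvgr_lt a).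
    move=> /filter_ex[n nn]; exists n => //=.
    by rewrite in_itv/= yb ltW.
  move=> [n _]/=; rewrite in_itv/= => /andP[y1 ->]; rewrite andbT.
  by rewrite (lt_le_trans _ y1)//; have /andP[] := s1 n.
have c1 : (\int[@lebesgue_measure R]_(x in `[F (s n), F b]) (G x)%:E)%E @[n --> \oo]
   --> (\int[@lebesgue_measure R]_(x in `]F a, F b]) (G x)%:E)%E.
  rewrite U1; apply: ge0_nondecreasing_set_cvg_integral => //.
  - move=> n m nm; apply/subsetPset => y /=; rewrite !in_itv/= => /andP[y1 ->].
    by rewrite andbT (le_trans _ y1)// incFle// sdec.
  - move=> n; apply/measurable_EFinP; apply: measurable_funS mG => //.
    move=> y /=; rewrite !in_itv/= => /andP[y1 ->].
    by rewrite (lt_le_trans _ y1)// incF//; have /andP[] := s1 n.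
  - move=> n y/=; rewrite in_itv/= => /andP[y1 _]; rewrite lee_fin G0//.
    by rewrite (lt_le_trans _ y1)// incF//; have /andP[] := s1 n.
have c2 : (\int[@lebesgue_measure R]_(x in `[s n, b]) (((G \o F) * F') x)%:E)%E @[n --> \oo]
   --> (\int[@lebesgue_measure R]_(x in `]a, b]) (((G \o F) * F') x)%:E)%E.
  rewrite U2; apply: ge0_nondecreasing_set_cvg_integral => //.
  - move=> n m nm; apply/subsetPset => y /=; rewrite !in_itv/= => /andP[y1 ->].
    by rewrite andbT (le_trans _ y1)// sdec.
  - move=> n; apply/measurable_EFinP; apply: measurable_funS mGF => //.
    move=> y /=; rewrite !in_itv/= => /andP[y1 ->].
    by rewrite (lt_le_trans _ y1)//; have /andP[] := s1 n.
  - move=> n y/=; rewrite in_itv/= => /andP[y1 yb]; rewrite lee_fin.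
    have ay : a < y by rewrite (lt_le_trans _ y1)//; have /andP[] := s1 n.
    rewrite mulr_ge0// ?F'0 ?in_itv/= ?ay// G0// incF//.
    by rewrite in_itv/= yb ltW.
rewrite -(cvg_lim _ c1)// -(cvg_lim _ c2)//; congr (limn _).
by apply/funext => n; exact: sE.
Qed.

(** * The three series expansions *)

(** Strips the constant (pi or a power of T) that the termwise integrals carry; convergence of
    [series u] is recovered by dividing by c. *)
Lemma lim_series_cM (R : realType) (c : R) (u : R^nat) : c != 0 ->
  cvgn (series (fun k => c * u k)) ->
  cvgn (series u) /\ limn (series (fun k => c * u k)) = c * limn (series u).
Proof.
move=> c0 cu.
have e : series (fun k => c * u k) = fun n => c * series u n.
  by apply/funext => n; rewrite /series/= mulr_sumr.
have cs : cvgn (series u).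
  have -> : series u = fun n => c^-1 * series (fun k => c * u k) n.
    by apply/funext => n; rewrite e mulKf.
  exact: is_cvgMr.
split => //; rewrite e; apply/cvg_lim => //.
by apply: cvgMr.
Qed.

Lemma is_cvg_series_cM (R : realType) (c : R) (u : R^nat) :
  cvgn (series u) -> cvgn (series (fun k => c * u k)).
Proof.
move=> cu.
have -> : series (fun k => c * u k) = fun n => c * series u n.
  by apply/funext => n; rewrite /series/= mulr_sumr.
exact: is_cvgMr.
Qed.

Lemma integrable_onep_sqrV (R : realType) :
  (@lebesgue_measure R).-integrable setT (fun s : R => ((1 + s ^+ 2)^-1)%:E).
Proof.
apply/integrableP; split.
  apply/measurable_EFinP; apply: continuous_measurable_fun => s.
  apply: cvgV; first by rewrite gt_eqF// onep_sqr_gt0.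
  by apply: cvgD; [exact: cvg_cst|exact: exprn_continuous].
under eq_integral.
  move=> s _; rewrite abse_EFin ger0_norm ?invr_ge0 ?ltW ?onep_sqr_gt0//.
  (* The weight is the Wallis integrand with m = 0, so its integral is finite. *)
  rewrite -[X in X%:E]mulr1 -(expr0 (s ^+ 2 / (1 + s ^+ 2))).
  over.
by rewrite wallis_integral ltry.
Qed.

Lemma ratio_onep_sqr (R : realType) (s : R) : 0 <= s ^+ 2 / (1 + s ^+ 2) <= 1.
Proof.
have p0 := onep_sqr_gt0 s; apply/andP; split; first by rewrite divr_ge0 ?sqr_ge0 ?ltW.
by rewrite ler_pdivrMr// mul1r lerDr ler01.
Qed.

Lemma continuous_ratio_onep_sqr (R : realType) :
  continuous (fun s : R => s ^+ 2 / (1 + s ^+ 2)).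
Proof.
move=> s; apply: cvgM; first exact: exprn_continuous.
apply: cvgV; first by rewrite gt_eqF// onep_sqr_gt0.
by apply: cvgD; [exact: cvg_cst|exact: exprn_continuous].
Qed.

(** The value is pi times the hypergeometric function 2F1(b, 1/2; 1; x). Since s^2/(1+s^2) lies in
    [0, 1], the binomial terms are dominated by their values at x. *)
Lemma angular_series (R : realType) (b x : R) : 0 <= x < 1 ->
  let ang m := binc b m * x ^+ m * binc (1 / 2) m in
  cvgn (series ang) /\
  (\int[@lebesgue_measure R]_s ((1 + s ^+ 2)^-1 *
      (1 - x * (s ^+ 2 / (1 + s ^+ 2))) `^ (- b))%:E
   = (pi * limn (series ang))%:E)%E.
Proof.
move=> /andP[x0 x1] ang.
have iw := integrable_onep_sqrV R.
have [] := @integral_dominated_series _ _ _ (@lebesgue_measure R) setT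
  (fun s : R => (1 + s ^+ 2)^-1)
  (fun s => (1 - x * (s ^+ 2 / (1 + s ^+ 2))) `^ (- b))
  (fun m s => binc b m * (x * (s ^+ 2 / (1 + s ^+ 2))) ^+ m)
  (fun m => `|binc b m * x ^+ m|) (fun m => pi * ang m).
- exact: measurableT.
- exact: iw.
- by move=> s _; rewrite invr_ge0 ltW// onep_sqr_gt0.
- move=> m; apply: continuous_measurable_fun => s; apply: cvgMr.
  have h : (fun s : R => x * (s ^+ 2 / (1 + s ^+ 2))) @ s --> x * (s ^+ 2 / (1 + s ^+ 2)).
    by apply: cvgMr; exact: continuous_ratio_onep_sqr.
  exact: (cvg_comp _ _ h (@exprn_continuous _ m _)).
- move=> m s _; have /andP[u0 u1] := ratio_onep_sqr s.
  rewrite exprMn mulrA normrM ler_piMr// ger0_norm ?exprn_ge0//.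
  exact: exprn_ile1.
- by apply: is_cvg_binc_norm; rewrite ger0_norm.
- move=> s _; apply: binomial_series; have /andP[u0 u1] := ratio_onep_sqr s.
  have xu0 : 0 <= x * (s ^+ 2 / (1 + s ^+ 2)) by exact: mulr_ge0.
  rewrite ger0_norm//; apply: le_lt_trans x1.
  by rewrite ler_piMr.
- move=> m; pose c := binc b m * x ^+ m.
  transitivity (\int[@lebesgue_measure R]_s (c%:E * ((1 + s ^+ 2)^-1 *
     (s ^+ 2 / (1 + s ^+ 2)) ^+ m)%:E))%E.
    apply: eq_integral => s _; rewrite -EFinM; congr EFin.
    by set u := s ^+ 2 / _; rewrite exprMn /c; move: (binc b m) (u ^+ m) => y z; ring.
  rewrite integralZl//.
    by rewrite wallis_integral -EFinM; congr EFin; rewrite /ang /c; ring.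
  apply: (le_integrable _ _ _ iw) => //.
    apply/measurable_EFinP; apply: measurable_funM.
      by apply/measurable_EFinP; case/integrableP : iw.
    apply: measurable_funX; apply: continuous_measurable_fun.
    exact: continuous_ratio_onep_sqr.
  move=> s _; have /andP[u0 u1] := ratio_onep_sqr s.
  rewrite !abse_EFin lee_fin normrM ler_piMr// ger0_norm ?exprn_ge0//.
  exact: exprn_ile1.
move=> /lim_series_cM [|cs ->]; first by rewrite gt_eqF// pi_gt0.
by move=> _ ->.
Qed.

Lemma integral_expr (R : realType) (T : R) (k : nat) : 0 < T ->
  (\int[@lebesgue_measure R]_(t in `]0%R, T]) (t ^+ k)%:E =
   (T ^+ k.+1 / k.+1%:R)%:E)%E.
Proof.
move=> T0.
have cX : continuous (fun t : R => t ^+ k) by exact: exprn_continuous.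
rewrite integral_itv_obnd_cbnd; last first.
  apply/measurable_EFinP; apply: measurable_funTS.
  exact: continuous_measurable_fun.
pose F (t : R) : R := k.+1%:R^-1 * t ^+ k.+1.
have dF (t : R) : is_derive t 1 F (t ^+ k).
  have d1 : is_derive t 1 (fun t : R => t ^+ k.+1) (k.+1%:R * t ^+ k).
    by apply: DeriveDef; [exact: exprn_derivable|rewrite exp_derive /GRing.scale/= mulr1].
  rewrite /F; apply: is_derive_eq; rewrite /GRing.scale/=.
  have k0 : k.+1%:R != 0 :> R by rewrite pnatr_eq0.
  by move: k.+1%:R k0 => N N0; field.
have cF (t : R) : {for t, continuous F}.
  by apply: differentiable_continuous; apply/derivable1_diffP; have [] := dF t.
rewrite (@continuous_FTC2 _ _ F)//.
- by rewrite /F expr0n/= mulr0 sube0 mulrC.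
- exact: continuous_subspaceT.
- split.
  + by move=> t _; have [] := dF t.
  + by apply: cvg_at_right_filter; exact: cF.
  + by apply: cvg_at_left_filter; exact: cF.
- by move=> t _; rewrite derive1E; have [_ ->] := dF t.
Qed.

(** Here t^(2p) is the weight and (1 - t^2)^(-2) is expanded, dominated termwise by its value at t =
    T < 1. The denominators are those of the integrals of t^(2(n+p)). *)
Lemma radial_moment (R : realType) (T : R) (p : nat) : 0 < T < 1 ->
  let rad n := binc 2 n * T ^+ (2 * n) / (2 * (n + p)%:R + 1) in
  cvgn (series rad) /\
  (\int[@lebesgue_measure R]_(t in `]0%R, T]) ((1 - t ^+ 2) ^- 2 * t ^+ (2 * p))%:E =
   (T ^+ (2 * p).+1 * limn (series rad))%:E)%E.
Proof.
move=> /andP[T0 T1] rad.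
have T21 : `|T ^+ 2| < 1.
  by rewrite ger0_norm ?sqr_ge0// expr_lt1// ltW.
have mI : measurable (`]0, T]%classic : set R) by [].
have [] := @integral_dominated_series _ _ _ (@lebesgue_measure R) `]0, T]%classic
  (fun t : R => t ^+ (2 * p)) (fun t : R => (1 - t ^+ 2) ^- 2)
  (fun n t => binc 2 n * (t ^+ 2) ^+ n)
  (fun n => `|binc 2 n * (T ^+ 2) ^+ n|) (fun n => T ^+ (2 * p).+1 * rad n).
- exact: mI.
- apply/integrableP; split.
    apply/measurable_EFinP; apply: measurable_funTS.
    by apply: continuous_measurable_fun; exact: exprn_continuous.
  under eq_integral.
    move=> t; rewrite inE/= in_itv/= => /andP[t0 _].
    rewrite ger0_norm ?exprn_ge0 ?ltW//.
    over.
  by rewrite integral_expr// ltry.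
- by move=> t; rewrite /= in_itv/= => /andP[t0 _]; rewrite exprn_ge0// ltW.
- move=> n; apply: measurable_funTS; apply: continuous_measurable_fun => t.
  apply: cvgMr.
  exact: (cvg_comp _ _ (@exprn_continuous _ 2 t) (@exprn_continuous _ n _)).
- move=> n t; rewrite /= in_itv/= => /andP[t0 tT].
  have t0' := ltW t0; have T0' := ltW T0.
  rewrite !normrM ler_wpM2l// !ger0_norm ?exprn_ge0//.
  by rewrite !lerXn2r ?nnegrE ?exprn_ge0.
- exact: is_cvg_binc_norm.
- move=> t; rewrite /= in_itv/= => /andP[t0 tT].
  have t21 : t ^+ 2 < 1 by rewrite expr_lt1 ?(le_lt_trans tT)// ltW.
  have -> : (1 - t ^+ 2) ^- 2 = (1 - t ^+ 2) `^ (- 2).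
    by rewrite -(@powR_invn _ _ 2)// subr_ge0 ltW.
  by apply: binomial_series; rewrite ger0_norm ?sqr_ge0.
- move=> n.
  transitivity (\int[@lebesgue_measure R]_(t in `]0%R, T])
     ((binc 2 n)%:E * (t ^+ (2 * (n + p)))%:E))%E.
    apply: eq_integral => t _; rewrite -EFinM; congr EFin.
    by rewrite mulrCA -exprM -exprD mulnDr addnC.
  rewrite integralZl//; last first.
    apply/integrableP; split.
      apply/measurable_EFinP; apply: measurable_funTS.
      by apply: continuous_measurable_fun; exact: exprn_continuous.
    under eq_integral.
      move=> t; rewrite inE/= in_itv/= => /andP[t0 _].
      rewrite ger0_norm ?exprn_ge0 ?ltW//.
      over.
    by rewrite integral_expr// ltry.
  rewrite integral_expr// -EFinM; congr EFin; rewrite /rad.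
  have -> : (2 * (n + p)).+1%:R = 2 * (n + p)%:R + 1 :> R.
    by rewrite -natr1 natrM.
  have -> : T ^+ (2 * (n + p)).+1 = T ^+ (2 * p).+1 * T ^+ (2 * n).
    by rewrite -exprD; congr (_ ^+ _); rewrite addSn mulnDr addnC.
  by ring.
move=> /lim_series_cM [|cs ->]; first by rewrite gt_eqF// exprn_gt0.
move=> _ <-; split => //.
by apply: eq_integral => t _; rewrite mulrC.
Qed.

(** The roles change: (1 - t^2)^(-2) is now the weight, with moments given by [radial_moment], and
    the square root is expanded, dominated at t = T through k T^2 < 1. *)
Lemma radial_series (R : realType) (T k : R) : 0 < T < 1 -> 0 <= k ->
  k * T ^+ 2 < 1 ->
  let N p := limn (series (fun n =>
    binc 2 n * T ^+ (2 * n) / (2 * (n + p)%:R + 1))) in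
  let rad p := binc (- (1 / 2)) p * (- (k * T ^+ 2)) ^+ p * N p in
  cvgn (series rad) /\
  (\int[@lebesgue_measure R]_(t in `]0%R, T])
     ((1 - t ^+ 2) ^- 2 * Num.sqrt (1 + k * t ^+ 2))%:E =
   (T * limn (series rad))%:E)%E.
Proof.
move=> /[dup] T01 /andP[T0 T1] k0 kT N rad.
have iN p := (radial_moment p T01).2.
have iw : (@lebesgue_measure R).-integrable `]0, T]%classic
    (fun t : R => ((1 - t ^+ 2) ^- 2)%:E).
  apply/integrableP; split.
    apply/measurable_EFinP; apply: measurable_funTS.
    apply: (measurableT_comp (@measurable_invr R)).
    apply: continuous_measurable_fun => t.
    have h : (fun t : R => 1 - t ^+ 2) @ t --> 1 - t ^+ 2.
      by apply: cvgB; [exact: cvg_cst|exact: exprn_continuous].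
    exact: (cvg_comp _ _ h (@exprn_continuous _ 2 _)).
  under eq_integral.
    move=> t _; rewrite abse_EFin ger0_norm ?invr_ge0 ?sqr_ge0//.
    (* Integrability of the weight is the moment p = 0. *)
    rewrite -[X in X%:E]mulr1 -(expr0 t) -(muln0 2).
    over.
  by rewrite iN ltry.
have [] := @integral_dominated_series _ _ _ (@lebesgue_measure R) `]0, T]%classic
  (fun t : R => (1 - t ^+ 2) ^- 2) (fun t => Num.sqrt (1 + k * t ^+ 2))
  (fun p t => binc (- (1 / 2)) p * (- (k * t ^+ 2)) ^+ p)
  (fun p => `|binc (- (1 / 2)) p * (k * T ^+ 2) ^+ p|) (fun p => T * rad p).
- by [].
- exact: iw.
- by move=> t _; rewrite invr_ge0 sqr_ge0.
- move=> p; apply: measurable_funTS; apply: continuous_measurable_fun => t.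
  apply: cvgMr.
  have h : (fun t : R => - (k * t ^+ 2)) @ t --> - (k * t ^+ 2).
    by apply: cvgN; apply: cvgMr; exact: exprn_continuous.
  exact: (cvg_comp _ _ h (@exprn_continuous _ p _)).
- move=> p t; rewrite /= in_itv/= => /andP[/ltW t0 tT].
  have T0' := ltW T0.
  have kt0 : 0 <= k * t ^+ 2 by rewrite mulr_ge0 ?sqr_ge0.
  have kT0 : 0 <= k * T ^+ 2 by rewrite mulr_ge0 ?sqr_ge0.
  rewrite !normrM ler_wpM2l// !normrX normrN (ger0_norm kt0) (ger0_norm kT0).
  by rewrite lerXn2r ?nnegrE// ler_wpM2l// lerXn2r ?nnegrE.
- by apply: is_cvg_binc_norm; rewrite ger0_norm// mulr_ge0 ?sqr_ge0.
- move=> t; rewrite /= in_itv/= => /andP[/ltW t0 tT].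
  have kt0 : 0 <= k * t ^+ 2 by rewrite mulr_ge0 ?sqr_ge0.
  have -> : Num.sqrt (1 + k * t ^+ 2) = (1 - - (k * t ^+ 2)) `^ (- - (1 / 2)).
    by rewrite !opprK mul1r powR12_sqrt// addr_ge0.
  apply: binomial_series; rewrite normrN ger0_norm//.
  apply: le_lt_trans kT; rewrite ler_wpM2l// lerXn2r ?nnegrE//.
  exact: ltW.
- move=> p; pose c := binc (- (1 / 2)) p * (- k) ^+ p.
  transitivity (\int[@lebesgue_measure R]_(t in `]0%R, T])
     (c%:E * ((1 - t ^+ 2) ^- 2 * t ^+ (2 * p))%:E))%E.
    apply: eq_integral => t _; rewrite -EFinM; congr EFin.
    rewrite -(mulNr k) (exprMn p) -exprM /c; move: (binc _ p) => y.
    by ring.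
  rewrite integralZl//.
    rewrite iN -EFinM; congr EFin; rewrite /rad /c -/(N p) -(mulNr k) (exprMn p) -exprM.
    by move: (binc _ p) (N p) => y z; rewrite exprS; ring.
  apply: (le_integrable _ _ _ iw) => //.
    apply/measurable_EFinP; apply: measurable_funM.
      by apply/measurable_EFinP; case/integrableP : iw.
    by apply: measurable_funTS; apply: continuous_measurable_fun; exact: exprn_continuous.
  move=> t; rewrite /= in_itv/= => /andP[/ltW t0 tT].
  rewrite lee_fin normrM ler_piMr// ger0_norm ?exprn_ge0//.
  by apply: exprn_ile1 => //; rewrite (le_trans tT)// ltW.
move=> /lim_series_cM [|cs ->]; first by rewrite gt_eqF.
by move=> _ ->.
Qed.

(** For each slope, [radial_series] with k v(s) in place of k supplies the inner sum over p. Its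
    p-th term carries v^p, and v^(p-3/2) integrates by [angular_series] with b = 3/2 - p. *)
Lemma area_series (R : realType) (T k x : R) : 0 < T < 1 -> 0 <= k ->
  k * T ^+ 2 < 1 -> 0 <= x < 1 ->
  let v s := 1 - x * (s ^+ 2 / (1 + s ^+ 2)) in
  let N p := limn (series (fun n =>
    binc 2 n * T ^+ (2 * n) / (2 * (n + p)%:R + 1))) in
  let A p := limn (series (fun m =>
    binc (3 / 2 - p%:R) m * x ^+ m * binc (1 / 2) m)) in
  let B p := binc (- (1 / 2)) p * (- (k * T ^+ 2)) ^+ p * N p * A p in
  let f s := (1 + s ^+ 2)^-1 * (v s `^ (- (3 / 2)) *
     limn (series (fun p =>
       binc (- (1 / 2)) p * (- (k * v s * T ^+ 2)) ^+ p * N p))) in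
  [/\ cvgn (series B), (@lebesgue_measure R).-integrable setT (EFin \o f) &
    (\int[@lebesgue_measure R]_s (f s)%:E = (pi * limn (series B))%:E)%E].
Proof.
move=> /[dup] T01 /andP[T0 T1] k0 kT x01 v N A B f.
have /andP[x0 x1] := x01.
have T0' := ltW T0.
have iw := integrable_onep_sqrV R.
have cN p := (radial_moment p T01).1.
have N0 p : 0 <= N p.
  apply: limr_ge => //; apply: nearW => n; rewrite /series/= sumr_ge0// => i _.
  rewrite divr_ge0 ?mulr_ge0 ?exprn_ge0//.
    exact: binc_ge0.
(* The denominators 2 (n + p) + 1 grow with p, so [N 0] bounds all the moments at once. *)
have NN p : N p <= N 0.
  apply: ler_lim => //; apply: nearW => n; rewrite /series/= ler_sum// => i _.
  rewrite ler_wpM2l//.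
    by rewrite mulr_ge0 ?exprn_ge0// binc_ge0.
  have h q : 0 < 2 * (i + q)%:R + 1 :> R by rewrite ltr_wpDl// mulr_ge0.
  by rewrite lef_pV2 ?posrE// lerD2r ler_wpM2l// ler_nat leq_add2l.
have kT0 : 0 <= k * T ^+ 2 by rewrite mulr_ge0 ?sqr_ge0.
have v1 s : 1 - x <= v s <= 1.
  have /andP[u0 u1] := ratio_onep_sqr s.
  by rewrite /v lerD2l lerN2 ler_piMr//= gerBl mulr_ge0.
have v0 s : 0 < v s by have /andP[+ _] := v1 s; apply: lt_le_trans; rewrite subr_gt0.
have cv : continuous v.
  move=> s; apply: cvgB; first exact: cvg_cst.
  by apply: cvgMr; exact: continuous_ratio_onep_sqr.
have cvp (b : R) : continuous (fun s => v s `^ b).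
  move=> s; have cb : {for v s, continuous (fun y : R => y `^ b)}.
    apply: differentiable_continuous; apply/derivable1_diffP.
    by have [] := is_derive1_powR b (v0 s).
  exact: (cvg_comp _ _ (cv s) cb).
(* The bound is uniform in s: v >= 1 - x controls the power -3/2, v <= 1 controls k v T^2, and [N p]
   is at most [N 0]. *)
have [] := @integral_dominated_series _ _ _ (@lebesgue_measure R) setT
  (fun s : R => (1 + s ^+ 2)^-1)
  (fun s => v s `^ (- (3 / 2)) * limn (series (fun p =>
       binc (- (1 / 2)) p * (- (k * v s * T ^+ 2)) ^+ p * N p)))
  (fun p s => v s `^ (- (3 / 2)) *
       (binc (- (1 / 2)) p * (- (k * v s * T ^+ 2)) ^+ p * N p))
  (fun p => (1 - x) `^ (- (3 / 2)) * N 0 * `|binc (- (1 / 2)) p * (k * T ^+ 2) ^+ p|)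
  (fun p => pi * B p).
- exact: measurableT.
- exact: iw.
- by move=> s _; rewrite invr_ge0 ltW// onep_sqr_gt0.
- move=> p; apply: continuous_measurable_fun => s; apply: cvgM; first exact: cvp.
  apply: cvgMl; apply: cvgMr.
  have h : (fun s : R => - (k * v s * T ^+ 2)) @ s --> - (k * v s * T ^+ 2).
    by apply: cvgN; apply: cvgMl; apply: cvgMr; exact: cv.
  exact: (cvg_comp _ _ h (@exprn_continuous _ p _)).
- move=> p s _; have /andP[vx v1'] := v1 s.
  have v0' := ltW (v0 s).
  have e1 : v s `^ (- (3 / 2)) <= (1 - x) `^ (- (3 / 2)).
    have x1' : 0 < 1 - x by rewrite subr_gt0.
    rewrite !powRN lef_pV2 ?posrE ?powR_gt0//.
    by rewrite ge0_ler_powR ?nnegrE//; exact: ltW.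
  have e2 : 0 <= k * v s * T ^+ 2 <= k * T ^+ 2.
    rewrite mulr_ge0 ?sqr_ge0 ?mulr_ge0//= mulrAC ler_piMr//.
  rewrite !normrM (ger0_norm (N0 p)) (ger0_norm (powR_ge0 _ _)) !normrX normrN.
  have /andP[e3 e4] := e2.
  rewrite (ger0_norm e3) (ger0_norm kT0).
  rewrite [leRHS](_ : _ = (1 - x) `^ (- (3 / 2)) * (`|binc (- (1 / 2)) p| * (k * T ^+ 2) ^+ p * N 0)); last by ring.
  apply: ler_pM => //; [exact: powR_ge0|by rewrite !mulr_ge0 ?exprn_ge0|].
  apply: ler_pM => //; first by rewrite mulr_ge0 ?exprn_ge0.
  by rewrite ler_wpM2l// lerXn2r ?nnegrE.
- by apply: is_cvg_series_cM; apply: is_cvg_binc_norm; rewrite ger0_norm.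
- move=> s _; have /andP[vx v1'] := v1 s.
  have [||cs _] := radial_series (k := k * v s) T01.
  - by rewrite mulr_ge0// ltW.
  - by apply: le_lt_trans kT; rewrite mulrAC ler_piMr.
  set u := fun p => binc _ p * _ * N p.
  have -> : series (fun p => v s `^ (- (3 / 2)) * u p) = fun n => v s `^ (- (3 / 2)) * series u n.
    by apply/funext => n; rewrite /series/= mulr_sumr.
  by apply: cvgMr.
- move=> p; pose c := binc (- (1 / 2)) p * (- (k * T ^+ 2)) ^+ p * N p.
  have [cA iA] := angular_series (3 / 2 - p%:R) x01.
  transitivity (\int[@lebesgue_measure R]_s
     (c%:E * ((1 + s ^+ 2)^-1 * v s `^ (- (3 / 2 - p%:R)))%:E))%E.
    apply: eq_integral => s _; rewrite -EFinM; congr EFin.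
    have -> : - (3 / 2 - p%:R) = - (3 / 2) + p%:R :> R by ring.
    rewrite powRD; last by apply/implyP => _; rewrite gt_eqF.
    rewrite powR_mulrn; last exact: ltW.
    have -> : - (k * v s * T ^+ 2) = - (k * T ^+ 2) * v s by ring.
    rewrite exprMn /c; move: (binc _ p) (N p) (_ `^ _) => y z w; ring.
  rewrite integralZl//.
    rewrite iA -EFinM; congr EFin; rewrite /B /c -/(A p).
    by move: (binc _ p) (N p) (A p) => y z w; ring.
  apply/integrableP; split.
    apply/measurable_EFinP; apply: measurable_funM.
      by apply/measurable_EFinP; case/integrableP : iw.
    by apply: continuous_measurable_fun; exact: cvp.
  under eq_integral.
    move=> s _; rewrite abse_EFin ger0_norm; last first.
      by rewrite mulr_ge0 ?powR_ge0// invr_ge0 ltW// onep_sqr_gt0.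
    over.
  by rewrite iA ltry.
move=> /lim_series_cM [|cs ->]; first by rewrite gt_eqF// pi_gt0.
by move=> iwf ->.
Qed.

(** * The area integral in slope coordinates *)

Lemma measurable_sqrt (R : realType) : measurable_fun setT (@Num.sqrt R).
Proof. exact: continuous_measurable_fun (@sqrt_continuous R). Qed.

Lemma measurable_quadric (R : realType) (u v : R) :
  measurable_fun setT (fun z : R * R => z.1 ^+ 2 / u + z.2 ^+ 2 / v).
Proof.
apply: measurable_funD.
  apply: measurable_funM => //; apply: measurable_funX; exact: measurable_fst.
apply: measurable_funM => //; apply: measurable_funX; exact: measurable_snd.
Qed.

Lemma area_integrand_outside (R : realType) (a b c : R) (z : R * R) :
  0 < a -> 0 < b -> 0 < c -> 1 < z.1 ^+ 2 / a ^+ 2 + z.2 ^+ 2 / b ^+ 2 ->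
  area_integrand a b c z =
  Num.sqrt (1 + c ^+ 2 * (z.1 ^+ 2 / a ^+ 4 + z.2 ^+ 2 / b ^+ 4) *
    (z.1 ^+ 2 / a ^+ 2 + z.2 ^+ 2 / b ^+ 2 - 1)^-1).
Proof.
case: z => x y /= a0 b0 c0 r1; set r := _ - 1.
have r0 : 0 < r by rewrite /r subr_gt0.
have s0 : 0 < Num.sqrt r by rewrite sqrtr_gt0.
have sr : Num.sqrt r ^+ 2 = r by rewrite sqr_sqrtr// ltW.
(* Serves both partial derivatives: [q] collects what is constant in the variable. *)
have key (p u q : R) : u != 0 -> p ^+ 2 / u ^+ 2 + q = r ->
   is_derive p 1 (fun t : R => c * Num.sqrt (t ^+ 2 / u ^+ 2 + q))
     (c * p / u ^+ 2 / Num.sqrt r).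
  move=> u0 e.
  pose f (t : R) : R := t ^+ 2 / u ^+ 2 + q.
  have df : is_derive p 1 f (2 * p / u ^+ 2).
    by rewrite /f; apply: is_derive_eq; rewrite /GRing.scale/=; ring.
  have ds : is_derive (f p) 1 (@Num.sqrt R) (2 * Num.sqrt r)^-1.
    by rewrite /f e; exact: is_derive1_sqrt.
  have dc := @is_derive1_comp R (@Num.sqrt R) f p _ _ ds df.
  have := @is_deriveZ _ _ _ (Num.sqrt \o f) c p 1 _ dc.
  rewrite /GRing.scale/=.
  rewrite (_ : c * ((2 * Num.sqrt r)^-1 * (2 * p / u ^+ 2)) = c * p / u ^+ 2 / Num.sqrt r)//.
  by field; rewrite u0 gt_eqF.
rewrite /area_integrand/= 2!derive1E /zfun.
have e1 : x ^+ 2 / a ^+ 2 + (y ^+ 2 / b ^+ 2 - 1) = r by rewrite addrA.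
have e2 : y ^+ 2 / b ^+ 2 + (x ^+ 2 / a ^+ 2 - 1) = r by rewrite addrCA addrA.
have -> : (fun t : R => c * Num.sqrt (t ^+ 2 / a ^+ 2 + y ^+ 2 / b ^+ 2 - 1)) =
   (fun t : R => c * Num.sqrt (t ^+ 2 / a ^+ 2 + (y ^+ 2 / b ^+ 2 - 1))).
  by apply/funext => t; rewrite addrA.
have -> : (fun t : R => c * Num.sqrt (x ^+ 2 / a ^+ 2 + t ^+ 2 / b ^+ 2 - 1)) =
   (fun t : R => c * Num.sqrt (t ^+ 2 / b ^+ 2 + (x ^+ 2 / a ^+ 2 - 1))).
  by apply/funext => t; rewrite addrCA addrA.
have [_ ->] := key _ _ _ (lt0r_neq0 a0) e1; have [_ ->] := key _ _ _ (lt0r_neq0 b0) e2.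
congr Num.sqrt; rewrite -addrA; congr (_ + _).
rewrite -[in RHS]sr; field.
by rewrite !gt_eqF.
Qed.

(** Each vertical section has at most two points. *)
Lemma ellipse_null (R : realType) (a b : R) : 0 < b ->
  (@lebesgue_measure R \x @lebesgue_measure R)%E
    [set z : R * R | z.1 ^+ 2 / a ^+ 2 + z.2 ^+ 2 / b ^+ 2 = 1] = 0%E.
Proof.
move=> b0; set E := [set z : R * R | _].
have mE : measurable E.
  rewrite -[E]setTI (_ : E = (fun z : R * R => z.1 ^+ 2 / a ^+ 2 + z.2 ^+ 2 / b ^+ 2) @^-1` [set 1])//.
  by apply: measurable_quadric => //; exact: measurable_set1.
rewrite /product_measure1/=.
apply: integral0_eq => x _ /=.
set q := b ^+ 2 * (1 - x ^+ 2 / a ^+ 2).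
apply: countable_lebesgue_measure0.
apply: (@sub_countable _ _ _ [set Num.sqrt q; - Num.sqrt q]); last exact: finite_set_countable.
apply: subset_card_le.
move=> y; rewrite /xsection/= inE/E/= => e.
have yq : y ^+ 2 = q.
  have -> : q = b ^+ 2 * (y ^+ 2 / b ^+ 2).
    by rewrite /q; congr (_ * _); rewrite -e /= addrAC subrr add0r.
  by rewrite mulrC divfK// sqrf_eq0 gt_eqF.
have : y ^+ 2 == Num.sqrt q ^+ 2 by rewrite sqr_sqrtr ?yq// -yq sqr_ge0.
by rewrite eqf_sqr => /orP[] /eqP ->; [left|right].
Qed.

(** With r = (1 - t^2)^(-1/2) one has r^2/(r^2 - 1) = 1/t^2 and r dr = t (1 - t^2)^(-2) dt. The
    factor t cancels the 1/t from the square root, which removes the singularity at r = 1. *)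
Lemma radial_substitution (R : realType) (T Q : R) : 0 < T < 1 -> 0 < Q ->
  (\int[@lebesgue_measure R]_(r in `]1%R, (Num.sqrt (1 - T ^+ 2))^-1%R])
     (r * Num.sqrt (1 + Q * (r ^+ 2 * (r ^+ 2 - 1)^-1)))%:E =
   \int[@lebesgue_measure R]_(t in `]0%R, T])
     (Num.sqrt Q * ((1 - t ^+ 2) ^- 2 * Num.sqrt (1 + Q^-1 * t ^+ 2)))%:E)%E.
Proof.
move=> /andP[T0 T1] Q0.
pose F (t : R) : R := (Num.sqrt (1 - t ^+ 2))^-1.
pose F' (t : R) : R := t * (Num.sqrt (1 - t ^+ 2))^-1 ^+ 3.
pose G (r : R) : R := r * Num.sqrt (1 + Q * (r ^+ 2 * (r ^+ 2 - 1)^-1)).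
have p0 (t : R) : 0 <= t < 1 -> 0 < 1 - t ^+ 2.
  by move=> /andP[t0 t1]; rewrite subr_gt0 expr_lt1.
have F0 : F 0 = 1 by rewrite /F expr0n/= subr0 sqrtr1 invr1.
have mG : measurable_fun setT G.
  apply: measurable_funM => //; apply: (measurableT_comp (@measurable_sqrt R)).
  apply: measurable_funD => //; apply: measurable_funM => //.
  apply: measurable_funM; first exact: measurable_funX.
  apply: (measurableT_comp (@measurable_invr R)).
  by apply: measurable_funB => //; exact: measurable_funX.
have mp : measurable_fun setT (fun t : R => Num.sqrt (1 - t ^+ 2)).
  apply: (measurableT_comp (@measurable_sqrt R)).
  by apply: measurable_funB => //; exact: measurable_funX.
have mF : measurable_fun setT F by exact: (measurableT_comp (@measurable_invr R)).
have mF' : measurable_fun setT F'.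
  by apply: measurable_funM => //; exact: measurable_funX.
have dF (t : R) : 0 <= t < 1 -> is_derive t 1 F (F' t).
  move=> t01; have pt := p0 _ t01.
  pose f (t : R) : R := 1 - t ^+ 2.
  have df : is_derive t 1 f (- (2 * t)).
    by rewrite /f; apply: is_derive_eq; rewrite /GRing.scale/=; ring.
  have ds : is_derive (f t) 1 (@Num.sqrt R) (2 * Num.sqrt (f t))^-1.
    exact: is_derive1_sqrt.
  have dc := @is_derive1_comp R (@Num.sqrt R) f t _ _ ds df.
  have s0 : (Num.sqrt \o f) t != 0 by rewrite /= gt_eqF// sqrtr_gt0.
  apply: (is_derive_eq (@is_deriveV _ (Num.sqrt \o f) t _ _ s0 dc)).
  rewrite /GRing.scale/= /F' /f in s0 *.
  by rewrite invfM; field.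
have cF (t : R) : 0 <= t < 1 -> {for t, continuous F}.
  move=> t01; apply: differentiable_continuous; apply/derivable1_diffP.
  by have [] := dF t t01.
have e : (\int[@lebesgue_measure R]_(x in `]F 0%R, F T]) (G x)%:E =
   \int[@lebesgue_measure R]_(x in `]0%R, T]) (((G \o F) * F') x)%:E)%E.
  apply: (@ge0_integration_by_substitution_incr_obnd _ _ _ _ _ _ 1) => //.
  - move=> x y; rewrite !in_itv/= => /andP[x0 xT] /andP[y0 yT] xy.
    have px : 0 < 1 - x ^+ 2 by rewrite p0// x0 (le_lt_trans xT).
    have py : 0 < 1 - y ^+ 2 by rewrite p0// y0 (le_lt_trans yT).
    rewrite /F ltf_pV2 ?posrE ?sqrtr_gt0// ltr_sqrt// ltrD2l ltrN2.
    by rewrite ltrXn2r.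
  - by move=> x; rewrite in_itv/= => /andP[/ltW x0 x1]; apply: dF; rewrite x0.
  - move=> x; rewrite in_itv/= => /andP[/ltW x0 x1].
    have h : F @ x --> F x by apply: cF; rewrite x0.
    apply: cvgM; first exact: cvg_id.
    exact: (cvg_comp _ _ h (@exprn_continuous _ 3 _)).
  - by apply: cvg_at_right_filter; apply: cF; rewrite lexx ltr01.
  - rewrite F0 => y y1.
    have y21 : 0 < y ^+ 2 - 1 by rewrite subr_gt0 expr_gt1// ltW// (lt_trans ltr01).
    have h : (fun r : R => 1 + Q * (r ^+ 2 * (r ^+ 2 - 1)^-1)) @ y -->
       1 + Q * (y ^+ 2 * (y ^+ 2 - 1)^-1).
      apply: cvgD; first exact: cvg_cst.
      apply: cvgMr; apply: cvgM; first exact: exprn_continuous.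
      apply: cvgV; first by rewrite gt_eqF.
      by apply: cvgB; [exact: exprn_continuous|exact: cvg_cst].
    apply: cvgM; first exact: cvg_id.
    exact: (cvg_comp _ _ h (@sqrt_continuous R _)).
  - by rewrite F0 => y y1; rewrite /G mulr_ge0 ?sqrtr_ge0// ltW// (lt_trans ltr01).
  - move=> x; rewrite in_itv/= => /andP[/ltW x0 x1].
    by rewrite /F' mulr_ge0// exprn_ge0// invr_ge0 sqrtr_ge0.
  - exact: measurable_funTS mG.
  - apply: measurable_funTS; apply: measurable_funM => //.
    exact: measurableT_comp.
rewrite F0 in e; rewrite -/(F T) e; apply: eq_integral => t.
rewrite inE/= in_itv/= => /andP[t0 tT]; congr EFin.
have t01 : 0 <= t < 1 by rewrite ltW// (le_lt_trans tT).
have pt := p0 _ t01.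
have sp0 : 0 < Num.sqrt (1 - t ^+ 2) by rewrite sqrtr_gt0.
have e2 : Num.sqrt (1 - t ^+ 2) ^+ 2 = 1 - t ^+ 2 by rewrite sqr_sqrtr// ltW.
rewrite [LHS]/( G (F t) * F' t) /G /F /F'.
set p := Num.sqrt (1 - t ^+ 2).
have pn : p != 0 by rewrite gt_eqF.
have -> : 1 + Q * (p^-1 ^+ 2 * (p^-1 ^+ 2 - 1)^-1) = Q * (1 + Q^-1 * t ^+ 2) / t ^+ 2.
  have et : t ^+ 2 = 1 - p ^+ 2 by rewrite e2; ring.
  have pt0 : 1 - p ^+ 2 != 0 by rewrite -et sqrf_eq0 gt_eqF.
  rewrite et; field.
  by rewrite pt0 pn (gt_eqF Q0).
have q0 : 0 <= 1 + Q^-1 * t ^+ 2.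
  by rewrite addr_ge0// mulr_ge0 ?sqr_ge0// invr_ge0 ltW.
have Q0' := ltW Q0.
rewrite sqrtrM ?mulr_ge0// sqrtrM// sqrtrV ?sqr_ge0// sqrtr_sqr gtr0_norm//.
rewrite -[X in X = _]/(p^-1 * (Num.sqrt Q * Num.sqrt (1 + Q^-1 * t ^+ 2) / t) * (t * p^-1 ^+ 3)) -e2 -/p; field.
by rewrite pn gt_eqF.
Qed.

Section area_over_slopes.
Variables (R : realType) (a b c lam : R).
Hypotheses (b0 : 0 < b) (ba : b < a) (c0 : 0 < c) (lam1 : 1 < lam).

Let a0 : 0 < a. Proof. exact: lt_trans ba. Qed.
Let rho (z : R * R) := z.1 ^+ 2 / a ^+ 2 + z.2 ^+ 2 / b ^+ 2.
Let g (z : R * R) := Num.sqrt (1 + c ^+ 2 * (z.1 ^+ 2 / a ^+ 4 + z.2 ^+ 2 / b ^+ 4) *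
    (rho z - 1)^-1).
Let E : set (R * R) := rho @^-1` `]1, lam ^+ 2].
Let F : R * R -> \bar R := (EFin \o g) \_ E.

Let mrho : measurable_fun setT rho. Proof. exact: measurable_quadric. Qed.

Let mE : measurable E.
Proof. by rewrite -[E]setTI; apply: mrho. Qed.

Let mg : measurable_fun setT g.
Proof.
apply: (measurableT_comp (@measurable_sqrt R)).
apply: measurable_funD => //; apply: measurable_funM.
  apply: measurable_funM => //; exact: measurable_quadric.
apply: (measurableT_comp (@measurable_invr R)).
exact: measurable_funB.
Qed.

Let mF : measurable_fun setT F.
Proof.
apply/(measurable_restrictT _ mE); apply: measurable_funTS.
exact/measurable_EFinP.
Qed.

Let F0 z : (0 <= F z)%E.
Proof. by apply: erestrict_ge0 => ? _; rewrite lee_fin sqrtr_ge0. Qed.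

(** Dropping the inner ellipse leaves [E], on which the integrand has the closed form [g]; [F]
    extends it by zero to a function measurable on the whole plane. *)
Let area_restrict :
  (\int[(@lebesgue_measure R \x @lebesgue_measure R)%E]_(z in region a b lam)
     (area_integrand a b c z)%:E =
   \int[(@lebesgue_measure R \x @lebesgue_measure R)%E]_z F z)%E.
Proof.
have mreg : measurable (region a b lam : set (R * R)).
  rewrite -[region a b lam]setTI (_ : region a b lam = rho @^-1` `[1, lam ^+ 2]).
    by apply: mrho.
  by apply/seteqP; split => z /=; rewrite in_itv.
pose N : set (R * R) := rho @^-1` [set 1].
have mN : measurable N by rewrite -[N]setTI; apply: mrho => //; exact: measurable_set1.
have DN : region a b lam `\` N = E.
  apply/seteqP; split => z; rewrite /E/= in_itv/= /region/= -/(rho z).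
    move=> [/andP[r1 ->]] /eqP r2; rewrite andbT lt_neqAle r1 andbT.
    by rewrite eq_sym.
  by move=> /andP[r1 r2]; rewrite (ltW r1) r2; split => // e; rewrite e ltxx in r1.
have fg : {in E, (fun z => (area_integrand a b c z)%:E) =1 EFin \o g}.
  move=> z; rewrite inE /E/= in_itv/= => /andP[r1 _]; congr EFin.
  exact: area_integrand_outside.
rewrite (@ge0_integral_setD_null _ _ R (@lebesgue_measure R \x @lebesgue_measure R)%E (region a b lam) N)//.
- rewrite DN /F integral_mkcond [RHS](_ : _ = \int[(@lebesgue_measure R \x @lebesgue_measure R)%E]_(z in E) (EFin \o g) z)%E.
    by rewrite -integral_mkcond; exact: eq_integral.
  by rewrite [RHS]integral_mkcond.
- exact: ellipse_null.
- by move=> z; rewrite lee_fin sqrtr_ge0.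
- rewrite DN; apply: (eq_measurable_fun (EFin \o g)).
    by move=> z zE; rewrite fg.
  by apply: measurable_funTS; exact/measurable_EFinP.
Qed.

Let x : R := 1 - b ^+ 2 / a ^+ 2.
Let v (s : R) : R := 1 - x * (s ^+ 2 / (1 + s ^+ 2)).

Let v0 s : 0 < v s.
Proof.
have /andP[u0 u1] := ratio_onep_sqr s.
have h : 0 < b ^+ 2 / a ^+ 2 by rewrite divr_gt0 ?exprn_gt0.
have x1 : 0 <= x.
  by rewrite subr_ge0 ler_pdivrMr ?exprn_gt0// mul1r lerXn2r ?nnegrE ?ltW.
rewrite /v subr_gt0; apply: (@le_lt_trans _ _ x); first by rewrite ler_piMr.
by rewrite /x ltrBlDr ltrDl.
Qed.

Let vE s : (1 + s ^+ 2) * v s = 1 + b ^+ 2 / a ^+ 2 * s ^+ 2.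
Proof. by rewrite /v /x; have := onep_sqr_gt0 s => /lt0r_neq0 s0; field; rewrite s0 gt_eqF. Qed.

(** A slope s stands for a whole line through the origin, so two opposite points share each radius;
    that is the factor 2. *)
Lemma area_over_slopes :
  (\int[(@lebesgue_measure R \x @lebesgue_measure R)%E]_(z in region a b lam)
     (area_integrand a b c z)%:E =
   \int[@lebesgue_measure R]_s ((2 * b ^+ 2 / ((1 + s ^+ 2) * v s))%:E *
      \int[@lebesgue_measure R]_(r in `]1%R, lam])
        (r * Num.sqrt (1 + c ^+ 2 / (a ^+ 2 * v s) * (r ^+ 2 * (r ^+ 2 - 1)^-1)))%:E))%E.
Proof.
pose k := b ^+ 2 / a ^+ 2.
have k0 : 0 < k by rewrite divr_gt0 ?exprn_gt0.
rewrite area_restrict (slope_coordinates mF F0 k0).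
apply: eq_integral => s _.
have s0 := onep_sqr_gt0 s; have vs := v0 s.
(* [al] is the positive abscissa at which the line of slope parameter s meets the ellipse rho = 1,
   so that x = al r gives rho = r^2. *)
have [al al0 al2] : exists2 al : R, 0 < al & al ^+ 2 = a ^+ 2 / ((1 + s ^+ 2) * v s).
  exists (a / Num.sqrt ((1 + s ^+ 2) * v s)).
    by rewrite divr_gt0// sqrtr_gt0 mulr_gt0.
  by rewrite exprMn exprVn sqr_sqrtr// ltW// mulr_gt0.
pose Q := c ^+ 2 / (a ^+ 2 * v s).
pose h (r : R) := `|r| * Num.sqrt (1 + Q * (r ^+ 2 * (r ^+ 2 - 1)^-1)).
pose I : set R := (fun r => r ^+ 2) @^-1` `]1, lam ^+ 2].
pose H : R -> \bar R := (EFin \o h) \_ I.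
have mX2 : measurable_fun setT (fun r : R => r ^+ 2) by exact: measurable_funX.
have mI : measurable I by rewrite -[I]setTI; apply: mX2.
have mh : measurable_fun setT h.
  apply: measurable_funM; first exact: normr_measurable.
  apply: (measurableT_comp (@measurable_sqrt R)).
  apply: measurable_funD => //; apply: measurable_funM => //.
  apply: measurable_funM => //.
  apply: (measurableT_comp (@measurable_invr R)).
  exact: measurable_funB.
have mH : measurable_fun setT H.
  by apply/(measurable_restrictT _ mI); apply: measurable_funTS; exact/measurable_EFinP.
have H0 r : (0 <= H r)%E.
  by apply: erestrict_ge0 => ? _; rewrite lee_fin mulr_ge0// sqrtr_ge0.
have mFs : measurable_fun setT (fun y : R => ((k * `|y|)%:E * F (y, k * y * s)%R)%E).
  apply: emeasurable_funM.
    by apply/measurable_EFinP; apply: measurable_funM => //; exact: normr_measurable.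
  apply: (measurableT_comp mF); apply: measurable_fun_pair => //=.
  by apply: measurable_funM => //; exact: mulrl_measurable.
rewrite (@ge0_integral_scale _ al)//; last 2 first.
- by rewrite gt_eqF.
- by move=> y; rewrite mule_ge0// lee_fin mulr_ge0// ltW.
have rhoE r : rho (al * r, k * (al * r) * s) = r ^+ 2.
  have D0 : a ^+ 2 + (b * s) ^+ 2 != 0.
    by rewrite gt_eqF// ltr_pwDl ?exprn_gt0// sqr_ge0.
  rewrite /rho/= !exprMn al2 /k vE; field.
  by rewrite D0 (gt_eqF a0) (gt_eqF b0).
transitivity (`|al|%:E * \int[@lebesgue_measure R]_r ((k * al)%R%:E * H r))%E.
  congr (_ * _)%E; apply: eq_integral => r _.
  rewrite /F /H /patch.
  have -> : ((al * r, k * (al * r) * s) \in E) = (r \in I).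
    by apply/idP/idP; rewrite !inE /E /I/= rhoE.
  case: ifPn => _; last by rewrite !mule0.
  rewrite /= -!EFinM; congr EFin; rewrite /g /h rhoE /= normrM (gtr0_norm al0).
  (* Here k = b^2/a^2 pays off: x^2/a^4 + y^2/b^4 = al^2 r^2 (1 + s^2)/a^4 = r^2/(a^2 v). *)
  rewrite [c ^+ 2 * _](_ : _ = Q * r ^+ 2); last first.
    rewrite !exprMn al2 /k /Q; field.
    by rewrite (gt_eqF a0) (gt_eqF b0) (gt_eqF s0) (gt_eqF vs).
  by rewrite !mulrA.
rewrite ge0_integralZl//; last by rewrite lee_fin mulr_ge0// ltW.
rewrite gtr0_norm// muleA -EFinM ge0_integral_even//; last first.
  move=> r; rewrite /H /patch.
  have -> : (- r \in I) = (r \in I) by apply/idP/idP; rewrite !inE /I/= sqrrN.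
  by case: ifPn => // _; rewrite /= /h normrN sqrrN.
rewrite muleA -EFinM; congr (_ * _)%E.
  (* One [al] comes from the dilation, [k * al] from the Jacobian k |x|, and 2 from evenness in
     r. *)
  have -> : al * (k * al) * 2 = 2 * k * al ^+ 2 by ring.
  by rewrite al2 /k; congr EFin; field; rewrite !gt_eqF.
rewrite /H -integral_mkcondr.
have -> : `]0, +oo[%classic `&` I = `]1, lam]%classic.
  have l0 : 0 < lam by exact: lt_trans lam1.
  apply/seteqP; split => r; rewrite /I/= !in_itv/= ?andbT.
    move=> [r0 /andP[r1 rl]]; have r0' := ltW r0; have l0' := ltW l0.
    move: r1 rl; rewrite expr_gt1// => -> /=.
    by rewrite ler_pXn2r// ?nnegrE.
  move=> /andP[r1 rl]; have r0 : 0 < r by exact: lt_trans r1.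
  have r0' := ltW r0; have l0' := ltW l0.
  by split => //; rewrite expr_gt1// r1/= ler_pXn2r// ?nnegrE.
apply: eq_integral => r; rewrite inE/= in_itv/= => /andP[r1 _].
by rewrite /h gtr0_norm// (lt_trans ltr01).
Qed.

End area_over_slopes.

(** * Pochhammer symbols of the triple series *)

Lemma lim_seriesM (R : realType) (c : R) (u : R^nat) : cvgn (series u) ->
  limn (series (fun k => c * u k)) = c * limn (series u).
Proof.
move=> cu.
have -> : series (fun k => c * u k) = fun n => c * series u n.
  by apply/funext => n; rewrite /series/= mulr_sumr.
by apply/cvg_lim => //; apply: cvgMr.
Qed.

(** The functional equation of Gamma at al + k - 1, stated once for both branches of [poch] so that
    an induction can cross index 0. *)
Lemma poch_pred (R : realType) (al : R) (k : int) : al + (k - 1)%:~R != 0 ->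
  poch al (k - 1) * (al + (k - 1)%:~R) = poch al k.
Proof.
case: k => [[|n]|j] h.
- rewrite sub0r -[- 1]/(Negz 0) in h *.
  rewrite /poch big_ord_recr !big_ord0 /= mul1r.
  rewrite NegzE intrN/= in h *.
  by rewrite mulVf.
- have e : Posz n.+1 - 1 = Posz n by rewrite -addn1 PoszD addrK.
  by rewrite e /poch big_ord_recr/=.
- have e : Negz j - 1 = Negz j.+1 by rewrite !NegzE -opprD -PoszD addn1.
  rewrite e in h *; rewrite /poch big_ord_recr/= NegzE intrN in h *.
  by rewrite invfM mulfVK.
Qed.

(** Reflection formula, by lowering the index one step at a time. At al = -1/2 it produces the
    parameter 3/2 - p of the angular series. *)
Lemma poch_subn (R : realType) (al : R) (p m : nat) :
  (forall k : int, al + k%:~R != 0) ->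
  poch al (p%:Z - m%:Z) * ((- 1) ^+ m * poch (1 - al - p%:R) m%:Z) = poch al p%:Z.
Proof.
move=> al0; elim: m => [|m IH].
  by rewrite subr0 expr0 mul1r /poch big_ord0 mulr1.
rewrite -IH -(poch_pred (al0 (p%:Z - m%:Z - 1))).
have -> : p%:Z - m.+1%:Z = p%:Z - m%:Z - 1.
  by rewrite -addn1 PoszD opprD addrA.
rewrite -mulrA; congr (_ * _).
rewrite [poch (1 - al - p%:R) m.+1%:Z]/poch big_ord_recr/=.
rewrite -[\prod_(i < m) _]/(poch (1 - al - p%:R) m%:Z).
rewrite !intrB -!pmulrn exprS; ring.
Qed.

Lemma poch_neq0 (R : realType) (al : R) (k : int) :
  (forall k : int, al + k%:~R != 0) -> poch al k != 0.
Proof.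
move=> al0; case: k => [n|j] /=; rewrite ?invr_eq0; apply/prodf_neq0 => i _.
  exact: (al0 (Posz i)).
have := al0 (Negz i); by rewrite NegzE intrN.
Qed.

(** Turns (1/2)_(n+p) / (3/2)_(n+p) into the denominator 2 (n + p) + 1 of the radial moments. *)
Lemma poch_half (R : realType) (N : nat) :
  poch (3 / 2 : R) N%:Z = poch (1 / 2) N%:Z * (2 * N%:R + 1).
Proof.
elim: N => [|N IH]; first by rewrite /poch !big_ord0; ring.
rewrite /poch !big_ord_recr/= in IH *; rewrite IH -natr1; by field.
Qed.

Lemma poch1 (R : realType) (m : nat) : poch (1 : R) m%:Z = m`!%:R.
Proof.
elim: m => [|m IH]; first by rewrite /poch big_ord0 fact0.
by rewrite /poch big_ord_recr/= in IH *; rewrite IH factS natrM mulrC nat1r.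
Qed.

Lemma half_neq_int (R : realType) (k : int) : - (1 / 2) + k%:~R != 0 :> R.
Proof.
apply/eqP => h.
have e : k%:~R = 1 / 2 :> R by move/eqP: h; rewrite addrC subr_eq0 => /eqP.
have : (0 < k)%R by rewrite -(ltr0z R) e; lra.
have : (k < 1)%R by rewrite -(ltrz1 R) e; lra.
by move=> k1 k0; move: (lt_le_trans k1 k0); rewrite ltxx.
Qed.

(** One (-1/2)_p cancels against (-1/2)_(p-m) by [poch_subn], leaving (-1)^m (3/2 - p)_m; the sign
    is absorbed by (-x)^m. For fixed p the indices m and n are then separated. *)
Lemma term_factor (R : realType) (x y w : R) (m n p : nat) :
  term (- x) y w m n p =
  binc (- (1 / 2)) p * w ^+ p * (binc 2 n * y ^+ n / (2 * (n + p)%:R + 1)) *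
  (binc (3 / 2 - p%:R) m * x ^+ m * binc (1 / 2) m).
Proof.
have h := half_neq_int R.
rewrite /term !unlock.
have := poch_subn p m h.
have -> : 1 - - (1 / 2) - p%:R = 3 / 2 - p%:R :> R by field.
have q0 := poch_neq0 (p%:Z - m%:Z) h.
have p30 : poch (3 / 2 : R) (n + p)%:Z != 0.
  by rewrite /poch; apply/prodf_neq0 => i _; rewrite gt_eqF// ltr_pwDl.
have N0 : 2 * (n + p)%:R + 1 != 0 :> R.
  by rewrite gt_eqF// ltr_wpDl// mulr_ge0.
rewrite poch_half in p30 *; rewrite poch1.
have f0 k : k`!%:R != 0 :> R by rewrite pnatr_eq0 -lt0n fact_gt0.
have P0 : poch (1 / 2 : R) (n + p)%:Z != 0.
  by move: p30; rewrite mulf_eq0 negb_or => /andP[].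
have -> : (- x) ^+ m = (- 1) ^+ m * x ^+ m by rewrite -exprMn mulN1r.
move: (poch _ (p%:Z - m%:Z)) q0 (poch (3 / 2 - p%:R) m%:Z) => q q0 r.
move: (f0 m) (f0 n) (f0 p) P0 N0; clear p30.
move: (m`!%:R : R) (n`!%:R : R) (p`!%:R : R) (poch (1 / 2) (n + p)%:Z) (2 * (n + p)%:R + 1).
move=> fm fn fp P N fm0 fn0 fp0 P0 N0.
move: (poch (- (1 / 2)) p%:Z) (poch 2 n%:Z) (poch (1 / 2) m%:Z) => u v z <-.
move: (x ^+ m) (y ^+ n) (w ^+ p) => xm yn wp.
have s1 : (- 1) ^+ m * (- 1) ^+ m = 1 :> R by rewrite -expr2 sqrr_sign.
move: ((- 1) ^+ m) s1 => e s1.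
(* The two signs (-1)^m are kept as an atom e, and e^2 = 1 is used only after [field]. *)
transitivity (e * e * (q * (e * r) / fp * wp * (v / fn * yn / N) * (r / fm * xm * (z / fm)))).
  by field; rewrite fm0 fn0 fp0 P0 N0 q0.
by rewrite s1 mul1r.
Qed.

Lemma radial_integral (R : realType) (T Q : R) : 0 < T < 1 -> 0 < Q ->
  Q^-1 * T ^+ 2 < 1 ->
  let N p := limn (series (fun n =>
    binc 2 n * T ^+ (2 * n) / (2 * (n + p)%:R + 1))) in
  (\int[@lebesgue_measure R]_(r in `]1%R, (Num.sqrt (1 - T ^+ 2))^-1%R])
     (r * Num.sqrt (1 + Q * (r ^+ 2 * (r ^+ 2 - 1)^-1)))%:E =
   (Num.sqrt Q * (T * limn (series (fun p =>
      binc (- (1 / 2)) p * (- (Q^-1 * T ^+ 2)) ^+ p * N p))))%:E)%E.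
Proof.
move=> T01 Q0 QT N; rewrite radial_substitution//.
have Qi0 : 0 <= Q^-1 by rewrite invr_ge0 ltW.
have [_ iR] := radial_series T01 Qi0 QT.
under eq_integral do rewrite EFinM.
rewrite ge0_integralZl//.
- by rewrite iR EFinM.
- apply/measurable_EFinP; apply: measurable_funTS; apply: measurable_funM.
    apply: (measurableT_comp (@measurable_invr R)); apply: measurable_funX.
    by apply: measurable_funB => //; exact: measurable_funX.
  apply: (measurableT_comp (@measurable_sqrt R)).
  by apply: measurable_funD => //; apply: measurable_funM => //; exact: measurable_funX.
- by move=> t _; rewrite lee_fin mulr_ge0 ?sqrtr_ge0// invr_ge0 sqr_ge0.
Qed.

Unset Implicit Arguments.

(* The triple series is read as the iterated series
   sum_p ( sum_n ( sum_m term m n p ) ), each one convergent. *)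
Theorem theorem4 (R : realType) (a b c H : R) :
  0 < b -> b < a -> 0 < c -> 0 < H ->
  let lam := Num.sqrt (1 + H ^+ 2 / c ^+ 2) in
  let X := b ^+ 2 / a ^+ 2 - 1 in
  let Y := 1 - 1 / lam ^+ 2 in
  let W := a ^+ 2 * (1 - lam ^+ 2) / (c ^+ 2 * lam ^+ 2) in
  `|W| < 1 ->
  (forall n p : nat, cvgn (series (fun m => term X Y W m n p))) /\
  (forall p : nat,
     cvgn (series (fun n => limn (series (fun m => term X Y W m n p))))) /\
  exists s : R,
    series (fun p => limn (series (fun n =>
                      limn (series (fun m => term X Y W m n p))))) @ \oo --> s /\
    (\int[(@lebesgue_measure R \x @lebesgue_measure R)%E]_(xy in region a b lam)
        (area_integrand a b c xy)%:E
     = (2 * pi * b ^+ 2 * c * Num.sqrt (lam ^+ 2 - 1) / (lam * a) * s)%:E)%E.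
Proof.
move=> b0 ba c0 H0 lam X Y W W1.
have a0 : 0 < a by exact: lt_trans ba.
have lam2 : lam ^+ 2 = 1 + H ^+ 2 / c ^+ 2.
  by rewrite sqr_sqrtr// addr_ge0// divr_ge0 ?sqr_ge0.
have lam21 : 1 < lam ^+ 2 by rewrite lam2 ltrDl divr_gt0// exprn_gt0.
have lam0 : 0 < lam by rewrite sqrtr_gt0 -lam2 (lt_trans ltr01).
have lam1 : 1 < lam by rewrite -(@expr_gt1 _ 2)// ltW.
pose x := 1 - b ^+ 2 / a ^+ 2.
have x01 : 0 <= x < 1.
  have h : 0 < b ^+ 2 / a ^+ 2 by rewrite divr_gt0// exprn_gt0.
  have h1 : b ^+ 2 / a ^+ 2 <= 1.
    have b0' := ltW b0; have a0' := ltW a0; have ba' := ltW ba.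
    by rewrite ler_pdivrMr ?exprn_gt0// mul1r lerXn2r ?nnegrE.
  by rewrite /x subr_ge0 h1/= ltrBlDr ltrDl.
have XE : X = - x by rewrite /x opprB.
(* [T] is the positive root of Y, written so that c T / a is visible in the prefactor. *)
pose T := Num.sqrt (lam ^+ 2 - 1) / lam.
have T0 : 0 < T by rewrite divr_gt0// sqrtr_gt0 subr_gt0.
have T2 : T ^+ 2 = Y.
  rewrite /T exprMn exprVn sqr_sqrtr ?subr_ge0 ?ltW// /Y.
  by field; rewrite gt_eqF.
have TlamE : 1 - T ^+ 2 = lam ^- 2 by rewrite T2 /Y; field; rewrite gt_eqF.
have T01 : 0 < T < 1.
  rewrite T0/= -(@expr_lt1 _ 2)//; last exact: ltW.
  by rewrite -subr_gt0 TlamE invr_gt0 exprn_gt0.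
have lamE : (Num.sqrt (1 - T ^+ 2))^-1 = lam.
  by rewrite TlamE sqrtrV ?sqr_ge0// sqrtr_sqr gtr0_norm// invrK.
pose k := a ^+ 2 / c ^+ 2.
have k0 : 0 <= k by rewrite divr_ge0// sqr_ge0.
have WE : W = - (k * T ^+ 2).
  by rewrite T2 /Y /W /k; field; rewrite !gt_eqF.
have kT : k * T ^+ 2 < 1.
  by move: W1; rewrite WE normrN ger0_norm// mulr_ge0// sqr_ge0.
have [cB ifs iB] := area_series T01 k0 kT x01.
set N := fun p => limn (series (fun n =>
  binc 2 n * T ^+ (2 * n) / (2 * (n + p)%:R + 1))) in ifs iB cB *.
set A := fun p => limn (series (fun m =>
    binc (3 / 2 - p%:R) m * x ^+ m * binc (1 / 2) m)) in cB iB.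
set B := fun p => binc (- (1 / 2)) p * (- (k * T ^+ 2)) ^+ p * N p * A p in cB iB.
have cA p := (angular_series (3 / 2 - p%:R) x01).1.
have cN p := (radial_moment p T01).1.
pose P p := binc (- (1 / 2)) p * W ^+ p.
pose U n p := binc 2 n * T ^+ (2 * n) / (2 * (n + p)%:R + 1).
have tE n p : (fun m => term X Y W m n p) =
    fun m => P p * U n p * (binc (3 / 2 - p%:R) m * x ^+ m * binc (1 / 2) m).
  by apply/funext => m; rewrite XE term_factor -T2 -exprM.
have lE n p : limn (series (fun m => term X Y W m n p)) = P p * A p * U n p.
  by rewrite tE lim_seriesM// mulrAC.
have lE2 p : (fun n => limn (series (fun m => term X Y W m n p))) =
    fun n => P p * A p * U n p by apply/funext => n; rewrite lE.
have lE3 p : limn (series (fun n => limn (series (fun m => term X Y W m n p)))) = B p.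
  by rewrite lE2 (lim_seriesM _ (cN p)) /B /P WE mulrAC.
split; first by move=> n p; rewrite tE; exact: is_cvg_series_cM.
split; first by move=> p; rewrite lE2; exact: (@is_cvg_series_cM _ (P p * A p) (fun n => U n p) (cN p)).
exists (limn (series B)); split.
  have -> : (fun p => limn (series (fun n =>
      limn (series (fun m => term X Y W m n p))))) = B by apply/funext.
  exact: cB.
rewrite area_over_slopes//.
pose v (s : R) : R := 1 - x * (s ^+ 2 / (1 + s ^+ 2)).
(* The stated prefactor is pi times [C]: 2 b^2 comes from the slopes, c/a from the root of Q, T from
   the radial integral, and pi from the Wallis integrals. *)
pose C := 2 * b ^+ 2 * c * T / a.
have v01 s : 0 < v s <= 1.
  have /andP[u0 u1] := ratio_onep_sqr s; have /andP[x0 x1] := x01.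
  rewrite /v subr_gt0 gerBl mulr_ge0// andbT.
  by apply: le_lt_trans x1; rewrite ler_piMr.
transitivity (\int[@lebesgue_measure R]_s (C%:E * ((1 + s ^+ 2)^-1 *
    (v s `^ (- (3 / 2)) * limn (series (fun p =>
       binc (- (1 / 2)) p * (- (k * v s * T ^+ 2)) ^+ p * N p))))%:E))%E.
  apply: eq_integral => s _; rewrite -/x -/(v s).
  have /andP[v0 v1] := v01 s.
  have Q0 : 0 < c ^+ 2 / (a ^+ 2 * v s) by rewrite divr_gt0 ?mulr_gt0 ?exprn_gt0.
  have QE : (c ^+ 2 / (a ^+ 2 * v s))^-1 = k * v s.
    by rewrite /k; field; rewrite !gt_eqF.
  rewrite -lamE radial_integral//; last first.
    rewrite QE; apply: le_lt_trans kT; rewrite mulrAC ler_piMr//.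
    by rewrite mulr_ge0// sqr_ge0.
  rewrite QE -!EFinM; congr EFin; set L := limn _.
  have sv : 0 < Num.sqrt (v s) by rewrite sqrtr_gt0.
  have -> : Num.sqrt (c ^+ 2 / (a ^+ 2 * v s)) = c / (a * Num.sqrt (v s)).
    have <- : Num.sqrt (a ^+ 2 * v s) = a * Num.sqrt (v s).
      by rewrite sqrtrM ?sqr_ge0// sqrtr_sqr gtr0_norm.
    rewrite (@sqrtrM _ (c ^+ 2)) ?sqr_ge0// sqrtr_sqr gtr0_norm// sqrtrV//.
    by rewrite mulr_ge0 ?sqr_ge0// ltW.
  (* The slope density contributes v^(-1) and the root of Q contributes v^(-1/2). *)
  have -> : v s `^ (- (3 / 2)) = (v s * Num.sqrt (v s))^-1.
    have -> : 3 / 2 = 1 + 2^-1 :> R by field.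
    rewrite powRN powRD; last by apply/implyP => _; rewrite gt_eqF.
    by rewrite powRr1 ?ltW// powR12_sqrt// ltW.
  rewrite /C; field.
  by rewrite (gt_eqF a0) (gt_eqF v0) (gt_eqF sv) (gt_eqF (onep_sqr_gt0 s)).
rewrite integralZl// iB -EFinM; congr EFin.
by rewrite /C /T; field; rewrite (gt_eqF a0) (gt_eqF lam0).
Qed.
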